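(* Let $a_0,a_1,a_2,b_0,b_1,b_2$ be real numbers and consider the Abel equation $$\frac{dx}{dt}=(a_0+a_1\cos(2\pi t)+a_2\sin(2\pi t))x^3+(b_0+b_1\cos(2\pi t)+b_2\sin(2\pi t))x^2 .$$ (a) The equation has a center at $x=0$ if and only if $a_0=b_0=a_2b_1-a_1b_2=0$. (b) If the equation does not have a center at $x=0$ and one of the conditions $a_0^2\ge a_1^2+a_2^2$, $b_0^2\ge b_1^2+b_2^2$, or $(a_2b_0-a_0b_2)^2+(a_0b_1-a_1b_0)^2\ge (a_2b_1-a_1b_2)^2$ holds, then it has at most one non-zero periodic orbit, and when this periodic orbit exists it is hyperbolic. (c) There exist choices of $a_0,a_1,a_2,b_0,b_1,b_2$ for which the equation has at least two non-zero hyperbolic periodic orbits.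
   Context: The equation is considered on the strip $[0,1]\times\mathbb{R}$. A periodic orbit is a solution $x(t)$ defined on all of $[0,1]$ with $x(0)=x(1)$; $x\equiv0$ is always one, and non-zero periodic orbits are the others. The Poincaré map is $\Pi(x_0)=x(1;x_0)$ where $x(t;x_0)$ is the solution with $x(0;x_0)=x_0$; a periodic orbit with initial condition $x_0$ is hyperbolic if $\Pi'(x_0)\ne1$. The equation has a center at the periodic orbit $x=0$ if there is a neighborhood of $0$ such that every solution starting at $t=0$ in this neighborhood is a periodic orbit. *)

(* Defs.v *)
From Stdlib Require Import Reals ClassicalEpsilon.
From Coquelicot Require Import Coquelicot.
Open Scope R_scope.

Definition coefA (a0 a1 a2 t : R) : R := a0 + a1 * cos (2 * PI * t) + a2 * sin (2 * PI * t).

Definition abel_field (a0 a1 a2 b0 b1 b2 t x : R) : R :=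
  coefA a0 a1 a2 t * x ^ 3 + coefA b0 b1 b2 t * x ^ 2.

Definition is_solution (a0 a1 a2 b0 b1 b2 : R) (x : R -> R) : Prop :=
  forall t, 0 <= t <= 1 -> is_derive x t (abel_field a0 a1 a2 b0 b1 b2 t (x t)).

Definition periodic_ic (a0 a1 a2 b0 b1 b2 x0 : R) : Prop :=
  exists x, is_solution a0 a1 a2 b0 b1 b2 x /\ x 0 = x0 /\ x 1 = x0.

(* Poincare map Pi(x0) = x(1; x0) (arbitrary value where the solution
   does not exist on [0,1]; that set is closed, so this does not affect
   derivatives at points of the (open) domain). *)
Definition poincare (a0 a1 a2 b0 b1 b2 x0 : R) : R :=
  epsilon (inhabits 0)
    (fun y => exists x, is_solution a0 a1 a2 b0 b1 b2 x /\ x 0 = x0 /\ x 1 = y).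

Definition hyperbolic (a0 a1 a2 b0 b1 b2 x0 : R) : Prop :=
  exists l, is_derive (poincare a0 a1 a2 b0 b1 b2) x0 l /\ l <> 1.

Definition has_center (a0 a1 a2 b0 b1 b2 : R) : Prop :=
  exists eps, 0 < eps /\
    forall x0, Rabs x0 < eps ->
      (exists x, is_solution a0 a1 a2 b0 b1 b2 x /\ x 0 = x0) /\
      (forall x, is_solution a0 a1 a2 b0 b1 b2 x -> x 0 = x0 -> x 1 = x0).

(* Main.v *)
(** Write S(t,x) = A x^3 + B x^2. Along a periodic orbit every integral
    of S f(x) vanishes. If D = p A + q B >= 0, the choice
    f = 1/(x^2 (p - q x)) makes the integral of (A x + B)/(p - q x) zero, and the
    difference of these identities for two orbits x, y is
    D (x - y)/((p - q x)(p - q y)), of constant sign: hence uniqueness. The same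
    weight reduces the integral of S_x to that of x^2 D/(p - q x), which gives
    hyperbolicity. When D vanishes identically the equation is separable.

    A nearby solution y = x + z satisfies a Bernoulli-type equation without
    constant term; after an integrating factor it reads w' = q w^2 + r w^3,
    for which small solutions stay within O(w(0)^2) of w(0). This provides both
    the derivative of the Poincare map and, around x = 0, the expansion whose
    first coefficients are a0, b0 and a2 b1 - a1 b2.

    For two orbits, take A = sin/1000 and B even about t = 1/2: then
    -x(1 - t) is a solution whenever x is. *)

Require Import Defs.
From Stdlib Require Import Reals Classical ClassicalEpsilon Lra Lia.
From Coquelicot Require Import Coquelicot.
Open Scope R_scope.

(** * Calculus on the unit interval *)

Lemma is_derive_continuous (f : R -> R) (t l : R) :
  is_derive f t l -> continuous f t.
Proof. intros H; apply (ex_derive_continuous f t); exists l; exact H. Qed.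

(** For an abstract function [auto_derive] leaves an eta-expanded [Derive] term; this replaces it by
    the derivative given by [H]. *)
Ltac rewrite_derive H :=
  match type of H with
  | is_derive ?f ?t ?l =>
    replace (Derive (fun x => f x) t) with l
      by (symmetry; exact (is_derive_unique f t l H))
  end.

Lemma mean_value (f df : R -> R) (s t : R) :
  0 <= s <= 1 -> 0 <= t <= 1 ->
  (forall r, 0 <= r <= 1 -> is_derive f r (df r)) ->
  exists c, 0 <= c <= 1 /\ f t - f s = df c * (t - s).
Proof.
intros Hs Ht H.
assert (Hin : forall r, Rmin s t <= r <= Rmax s t -> 0 <= r <= 1).
{ unfold Rmin, Rmax; destruct (Rle_dec s t); intros; lra. }
destruct (MVT_gen f s t df) as [c [Hc E]].
- intros r Hr; apply H, Hin; lra.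
- intros r Hr; apply continuity_pt_filterlim.
  apply (is_derive_continuous f r (df r)), H, Hin, Hr.
- exists c; split; [apply Hin, Hc | exact E].
Qed.

Lemma derive_bounded (f df : R -> R) (M t : R) :
  0 <= t <= 1 ->
  (forall r, 0 <= r <= 1 -> is_derive f r (df r)) ->
  (forall r, 0 <= r <= 1 -> Rabs (df r) <= M) ->
  Rabs (f t - f 0) <= M.
Proof.
intros Ht H HM.
destruct (mean_value f df 0 t) as [c [Hc E]]; try lra; auto.
rewrite E, Rabs_mult, Rminus_0_r, (Rabs_pos_eq t) by lra.
specialize (HM c Hc); pose proof (Rabs_pos (df c)).
nra.
Qed.

Lemma derive_zero_constant (f : R -> R) (s t : R) :
  0 <= s <= 1 -> 0 <= t <= 1 ->
  (forall r, 0 <= r <= 1 -> is_derive f r 0) -> f t = f s.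
Proof.
intros Hs Ht H.
destruct (mean_value f (fun _ => 0) s t) as [c [_ E]]; auto; lra.
Qed.

Lemma derive_nonpos_decreasing (f df : R -> R) (s t : R) :
  0 <= s -> s <= t -> t <= 1 ->
  (forall r, 0 <= r <= 1 -> is_derive f r (df r)) ->
  (forall r, 0 <= r <= 1 -> df r <= 0) -> f t <= f s.
Proof.
intros Hs Hst Ht H Hdf.
destruct (mean_value f df s t) as [c [Hc E]]; try lra; auto.
specialize (Hdf c Hc); nra.
Qed.

(** A monotone function with equal end values is constant. The point [t] is interior because
    constancy is known only on [0,1], while the derivative is two-sided. *)
Lemma decreasing_equal_ends (f df : R -> R) (t : R) :
  (forall r, 0 <= r <= 1 -> is_derive f r (df r)) ->
  (forall r, 0 <= r <= 1 -> df r <= 0) ->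
  f 0 = f 1 -> 0 < t < 1 -> df t = 0.
Proof.
intros H Hdf E Ht.
assert (Hc : forall s, 0 <= s <= 1 -> f s = f 0).
{ intros s Hs.
  assert (f s <= f 0) by (apply (derive_nonpos_decreasing f df); auto; lra).
  assert (f 1 <= f s) by (apply (derive_nonpos_decreasing f df); auto; lra).
  lra. }
assert (H0 : is_derive f t 0).
{ apply is_derive_ext_loc with (fun _ => f 0).
  - assert (Hd : 0 < Rmin t (1 - t)) by (apply Rmin_pos; lra).
    exists (mkposreal _ Hd); intros s Hs.
    change (Rabs (s - t) < Rmin t (1 - t)) in Hs.
    symmetry; apply Hc.
    pose proof (Rmin_l t (1 - t)); pose proof (Rmin_r t (1 - t)).
    apply Rabs_def2 in Hs; lra.
  - exact (is_derive_const (f 0) t). }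
rewrite <- (is_derive_unique _ _ _ H0); symmetry.
apply is_derive_unique, H; lra.
Qed.

Lemma is_RInt_ext01 (f g : R -> R) (l : R) :
  (forall t, 0 < t < 1 -> f t = g t) -> is_RInt f 0 1 l -> is_RInt g 0 1 l.
Proof.
intros H; apply is_RInt_ext; rewrite Rmin_left, Rmax_right by lra; exact H.
Qed.

Lemma is_RInt_Rminus (f g : R -> R) (a b l m : R) :
  is_RInt f a b l -> is_RInt g a b m -> is_RInt (fun t => f t - g t) a b (l - m).
Proof. apply (is_RInt_minus f g). Qed.

(** The projection onto [0,1], written with absolute values so that its continuity is immediate.
    Composing with it extends a function continuous on [0,1] to one continuous on the whole line. *)
Definition clamp (t : R) : R := (Rabs t - Rabs (t - 1) + 1) / 2.

Lemma clamp_range (t : R) : 0 <= clamp t <= 1.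
Proof.
unfold clamp, Rabs; destruct (Rcase_abs t), (Rcase_abs (t - 1)); lra.
Qed.

Lemma clamp_id (t : R) : 0 <= t <= 1 -> clamp t = t.
Proof.
unfold clamp, Rabs; destruct (Rcase_abs t), (Rcase_abs (t - 1)); lra.
Qed.

Lemma continuous_clamp (t : R) : continuous clamp t.
Proof.
unfold clamp, Rdiv.
apply (continuous_mult (fun t => Rabs t - Rabs (t - 1) + 1) (fun _ => / 2));
  [|apply continuous_const].
apply (continuous_plus (fun t => Rabs t - Rabs (t - 1)) (fun _ => 1));
  [|apply continuous_const].
apply (continuous_minus Rabs (fun t => Rabs (t - 1))).
- apply continuous_Rabs.
- apply continuous_Rabs_comp.
  apply (continuous_minus (fun t => t) (fun _ => 1));
    [apply continuous_id | apply continuous_const].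
Qed.

Definition cont01 (f : R -> R) : Prop := forall t, 0 <= t <= 1 -> continuous f t.

Lemma continuous_comp_clamp (f : R -> R) (t : R) :
  cont01 f -> continuous (fun s => f (clamp s)) t.
Proof.
intros H; apply (continuous_comp clamp f); [apply continuous_clamp|].
apply H, clamp_range.
Qed.

Lemma derive_RInt_continuous (f : R -> R) (t : R) :
  (forall s, continuous f s) -> is_derive (RInt f 0) t (f t).
Proof.
intros H; apply (is_derive_RInt f (RInt f 0) 0); [|apply H].
apply filter_forall; intros s; apply (RInt_correct f).
apply (ex_RInt_continuous f); intros; apply H.
Qed.

(** Integrating [f] composed with [clamp] gives a function with two-sided derivatives at 0 and 1 as
    well. *)
Lemma antiderivative01 (f : R -> R) :
  cont01 f ->
  exists F, F 0 = 0 /\ (forall t, 0 <= t <= 1 -> is_derive F t (f t)) /\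
    is_RInt f 0 1 (F 1).
Proof.
intros H; exists (RInt (fun s => f (clamp s)) 0); split; [|split].
- apply (RInt_point 0 (fun s => f (clamp s))).
- intros t Ht; rewrite <- (clamp_id t Ht) at 2.
  apply (derive_RInt_continuous (fun s => f (clamp s))).
  intros s; apply continuous_comp_clamp, H.
- apply is_RInt_ext01 with (fun s => f (clamp s)).
  + intros t Ht; rewrite clamp_id; auto; lra.
  + apply (RInt_correct (fun s => f (clamp s))), (ex_RInt_continuous (fun s => f (clamp s))).
    intros; apply continuous_comp_clamp, H.
Qed.

Lemma integral_derive (F f : R -> R) :
  (forall t, 0 <= t <= 1 -> is_derive F t (f t)) -> cont01 f ->
  is_RInt f 0 1 (F 1 - F 0).
Proof.
intros HF Hf; apply (is_RInt_derive F f);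
  rewrite Rmin_left, Rmax_right by lra; auto.
Qed.

Lemma integral_nonneg_eq0 (f : R -> R) (t : R) :
  cont01 f -> (forall s, 0 <= s <= 1 -> 0 <= f s) -> is_RInt f 0 1 0 ->
  0 < t < 1 -> f t = 0.
Proof.
intros Hc Hp HI Ht.
destruct (antiderivative01 f Hc) as [F [F0 [dF IF]]].
assert (E : F 1 = 0).
{ rewrite <- (is_RInt_unique _ _ _ _ IF); apply (is_RInt_unique f), HI. }
assert (Hd : - f t = 0); [|lra].
apply (decreasing_equal_ends (fun s => - F s) (fun s => - f s)); auto.
- intros s Hs; apply (is_derive_opp F); auto.
- intros s Hs; specialize (Hp s Hs); lra.
- lra.
Qed.

Lemma cont01_bounded (f : R -> R) :
  cont01 f -> exists M, 0 < M /\ forall t, 0 <= t <= 1 -> Rabs (f t) <= M.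
Proof.
intros H.
destruct (continuity_ab_maj (fun t => Rabs (f t)) 0 1) as [m [Hm _]]; [lra| |].
- intros t Ht; apply continuity_pt_filterlim.
  apply (continuous_Rabs_comp f), H, Ht.
- exists (Rabs (f m) + 1); split.
  + pose proof (Rabs_pos (f m)); lra.
  + intros t Ht; specialize (Hm t Ht); simpl in Hm; lra.
Qed.

(** * Linear differential equations *)

Lemma linear_ode (w al E : R -> R) :
  (forall t, 0 <= t <= 1 -> is_derive w t (al t * w t)) ->
  E 0 = 0 -> (forall t, 0 <= t <= 1 -> is_derive E t (al t)) ->
  forall t, 0 <= t <= 1 -> w t = w 0 * exp (E t).
Proof.
intros Hw E0 HE t Ht.
assert (H : w t * exp (- E t) = w 0 * exp (- E 0)).
{ apply (derive_zero_constant (fun t => w t * exp (- E t))); try lra.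
  intros s Hs; specialize (Hw s Hs); specialize (HE s Hs).
  auto_derive.
  - repeat split; eexists; eassumption.
  - rewrite_derive Hw; rewrite_derive HE; ring. }
rewrite E0, Ropp_0, exp_0, Rmult_1_r in H.
rewrite <- H, Rmult_assoc, <- exp_plus, Rplus_opp_l, exp_0; ring.
Qed.

(** An exponential never vanishes, so one zero of [w] forces [w 0 = 0]. This yields uniqueness of
    solutions and the invariance of special levels. *)
Lemma linear_ode_zero (w al : R -> R) (s t : R) :
  cont01 al -> (forall t, 0 <= t <= 1 -> is_derive w t (al t * w t)) ->
  0 <= s <= 1 -> 0 <= t <= 1 -> w s = 0 -> w t = 0.
Proof.
intros Hal Hw Hs Ht H.
destruct (antiderivative01 al Hal) as [E [E0 [dE _]]].
rewrite (linear_ode w al E Hw E0 dE t Ht).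
rewrite (linear_ode w al E Hw E0 dE s Hs) in H.
apply Rmult_integral in H; destruct H as [->|H]; [ring|].
pose proof (exp_pos (E s)); lra.
Qed.

(* With the integrating factor, [w] can cross zero only downwards; being
   periodic, it cannot cross at all. *)
Lemma periodic_touching_zero (w al be : R -> R) (t0 : R) :
  cont01 al ->
  (forall t, 0 <= t <= 1 -> is_derive w t (al t * w t - be t)) ->
  (forall t, 0 <= t <= 1 -> 0 <= be t) ->
  w 0 = w 1 -> 0 <= t0 <= 1 -> w t0 = 0 ->
  w 0 = 0 /\ forall t, 0 < t < 1 -> be t = 0.
Proof.
intros Hal Hw Hbe Hp Ht0 H0.
destruct (antiderivative01 al Hal) as [E [E0 [dE _]]].
set (m := fun t => w t * exp (- E t)).
set (dm := fun t => - (be t * exp (- E t))).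
assert (Hm : forall t, 0 <= t <= 1 -> is_derive m t (dm t)).
{ intros s Hs; specialize (Hw s Hs); specialize (dE s Hs); unfold m, dm.
  auto_derive.
  - repeat split; eexists; eassumption.
  - rewrite_derive Hw; rewrite_derive dE; ring. }
assert (Hdm : forall t, 0 <= t <= 1 -> dm t <= 0).
{ intros t Ht; unfold dm; specialize (Hbe t Ht).
  pose proof (exp_pos (- E t)); nra. }
assert (Hm0 : m t0 = 0) by (unfold m; rewrite H0; ring).
assert (m t0 <= m 0) by (apply (derive_nonpos_decreasing m dm); auto; lra).
assert (m 1 <= m t0) by (apply (derive_nonpos_decreasing m dm); auto; lra).
assert (Ha : 0 <= w 0).
{ pose proof (exp_pos (- E 0)); unfold m at 2 in H; nra. }
assert (Hb : w 1 <= 0).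
{ pose proof (exp_pos (- E 1)); unfold m at 1 in H1; nra. }
assert (Hz : w 0 = 0) by lra.
split; [exact Hz|]; intros t Ht.
assert (Hd : dm t = 0).
{ apply (decreasing_equal_ends m dm); auto.
  unfold m; rewrite <- Hp, Hz; ring. }
unfold dm in Hd; pose proof (exp_pos (- E t)); nra.
Qed.

(** * Contractions and small solutions *)

Lemma uniform_limit_continuous (u : nat -> R -> R) (y : R -> R) (e : nat -> R) :
  (forall n t, continuous (u n) t) -> is_lim_seq e 0 ->
  (forall n t, Rabs (u n t - y t) <= e n) -> forall t, continuous y t.
Proof.
intros Hu He Huy t.
apply continuity_pt_filterlim.
apply (CVU_continuity u y t (mkposreal 1 Rlt_0_1)).
- intros eps Heps.
  destruct (proj2 (is_lim_seq_spec _ _) He (mkposreal eps Heps)) as [N HN].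
  exists N; intros n s Hn _.
  specialize (HN n Hn); simpl in HN; rewrite Rminus_0_r in HN.
  rewrite Rabs_minus_sym.
  apply Rle_lt_trans with (1 := Huy n s), Rle_lt_trans with (2 := HN), Rle_abs.
- intros n s _; apply continuity_pt_filterlim, Hu.
- unfold Boule; simpl; rewrite Rminus_diag, Rabs_R0; lra.
Qed.

(** Banach's theorem with ratio 1/2 in the sup norm, on the ball of radius [rho] about the constant
    [c]; the iteration starts at [c]. *)
Lemma contraction_fixed_point (F : (R -> R) -> R -> R) (c rho : R) :
  let K := fun y : R -> R =>
    (forall t, continuous y t) /\ (forall t, Rabs (y t - c) <= rho) in
  0 <= rho ->
  (forall y, K y -> K (F y)) ->
  (forall y z d, K y -> K z -> 0 <= d -> (forall t, Rabs (y t - z t) <= d) ->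
     forall t, Rabs (F y t - F z t) <= d / 2) ->
  exists y, K y /\ forall t, F y t = y t.
Proof.
intros K Hrho HK HF.
set (u := fun n => Nat.iter n F (fun _ => c)).
assert (Ku : forall n, K (u n)).
{ induction n; [|apply HK, IHn]; split; simpl; intros t.
  - apply continuous_const.
  - rewrite Rminus_diag, Rabs_R0; exact Hrho. }
assert (Hp : forall n, 0 < (/2) ^ n) by (intros; apply pow_lt; lra).
assert (Hu1 : forall n t, Rabs (u (S n) t - u n t) <= rho * (/2) ^ n).
{ induction n; intros t.
  - rewrite Rmult_1_r; apply (Ku 1%nat).
  - replace (rho * (/2) ^ S n) with (rho * (/2) ^ n / 2) by (simpl; field).
    apply (HF (u (S n)) (u n)); auto.
    apply Rmult_le_pos; [lra | apply Rlt_le, Hp]. }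
set (e := fun n => 2 * rho * (/2) ^ n).
assert (He : is_lim_seq e 0).
{ replace (Finite 0) with (Rbar_mult (2 * rho) 0) by (simpl; f_equal; ring).
  apply is_lim_seq_scal_l, is_lim_seq_geom.
  rewrite Rabs_pos_eq; lra. }
assert (Huk : forall n k t, Rabs (u (n + k)%nat t - u n t) <= e n).
(* The exact partial sum of the geometric series, so that the induction on [k] closes. *)
{ intros n k t; apply Rle_trans with (e n * (1 - (/2) ^ k)).
  - induction k.
    + rewrite Nat.add_0_r, Rminus_diag, Rabs_R0; simpl; lra.
    + rewrite Nat.add_succ_r.
      replace (u (S (n + k)) t - u n t)
        with ((u (S (n + k)) t - u (n + k)%nat t) + (u (n + k)%nat t - u n t))
        by ring.
      apply Rle_trans with (1 := Rabs_triang _ _).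
      specialize (Hu1 (n + k)%nat t); rewrite pow_add in Hu1.
      replace (e n * (1 - (/2) ^ S k))
        with (rho * ((/2) ^ n * (/2) ^ k) + e n * (1 - (/2) ^ k))
        by (unfold e; simpl; field).
      lra.
  - assert (0 <= e n).
    { unfold e; specialize (Hp n); nra. }
    specialize (Hp k); nra. }
set (y := fun t => real (Lim_seq (fun n => u n t))).
assert (Hlim : forall t, is_lim_seq (fun n => u n t) (y t)).
{ intros t; assert (Hex : ex_finite_lim_seq (fun n => u n t));
    [|destruct Hex as [l Hl]; unfold y; rewrite (is_lim_seq_unique _ _ Hl); exact Hl].
  apply ex_lim_seq_cauchy_corr; intros eps.
  destruct (proj2 (is_lim_seq_spec _ _) He (pos_div_2 eps)) as [N HN].
  exists N; intros n m Hn Hm.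
  specialize (HN N (le_n _)); rewrite Rminus_0_r in HN.
  apply Rle_lt_trans with (1 := Rle_abs _) in HN; simpl in HN.
  replace (u n t - u m t) with ((u n t - u N t) + - (u m t - u N t)) by ring.
  apply Rle_lt_trans with (1 := Rabs_triang _ _); rewrite Rabs_Ropp.
  pose proof (Huk N (n - N)%nat t) as H1.
  pose proof (Huk N (m - N)%nat t) as H2.
  replace (N + (n - N))%nat with n in H1 by lia.
  replace (N + (m - N))%nat with m in H2 by lia.
  lra. }
assert (Huy : forall n t, Rabs (u n t - y t) <= e n).
{ intros n t; rewrite Rabs_minus_sym.
  apply (is_lim_seq_le (fun k => Rabs (u (k + n)%nat t - u n t)) (fun _ => e n)
           (Rabs (y t - u n t)) (e n)).
  - intros k; rewrite Nat.add_comm; apply Huk.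
  - apply (is_lim_seq_abs (fun k => u (k + n)%nat t - u n t) (y t - u n t)).
    apply is_lim_seq_minus'; [|apply is_lim_seq_const].
    apply (is_lim_seq_incr_n (fun k => u k t)), Hlim.
  - apply is_lim_seq_const. }
assert (Ky : K y).
{ split.
  - apply (uniform_limit_continuous u y e); auto; intros n; apply Ku.
  - intros t.
    apply (is_lim_seq_le (fun k => Rabs (u k t - c)) (fun _ => rho)
             (Rabs (y t - c)) rho).
    + intros k; apply Ku.
    + apply (is_lim_seq_abs (fun k => u k t - c) (y t - c)).
      apply is_lim_seq_minus'; [apply Hlim | apply is_lim_seq_const].
    + apply is_lim_seq_const. }
exists y; split; [exact Ky|]; intros t.
assert (Hz : Rabs (F y t - y t) <= 0).
{ apply (is_lim_seq_le (fun _ => Rabs (F y t - y t)) e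
           (Rabs (F y t - y t)) 0); [|apply is_lim_seq_const|exact He].
  intros n.
  replace (F y t - y t) with (- (u (S n) t - F y t) + (u (S n) t - y t)) by ring.
  apply Rle_trans with (1 := Rabs_triang _ _); rewrite Rabs_Ropp.
  assert (H1 : Rabs (u (S n) t - F y t) <= e n / 2).
  { apply (HF (u n) y); auto.
    unfold e; specialize (Hp n); nra. }
  specialize (Huy (S n) t).
  replace (e (S n)) with (e n / 2) in Huy by (unfold e; simpl; field).
  lra. }
pose proof (Rabs_pos (F y t - y t)).
apply Rminus_diag_uniq; destruct (Req_dec (F y t - y t) 0) as [|N]; auto.
apply Rabs_pos_lt in N; lra.
Qed.

Lemma continuous_RInt_clamp (f : R -> R) (t : R) :
  (forall s, continuous f s) -> continuous (fun s => RInt f 0 (clamp s)) t.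
Proof.
intros H; apply (continuous_comp clamp (RInt f 0)); [apply continuous_clamp|].
apply (is_derive_continuous (RInt f 0) _ (f (clamp t))).
apply derive_RInt_continuous, H.
Qed.

Lemma RInt_bound01 (f : R -> R) (M t : R) :
  (forall s, continuous f s) -> 0 <= t <= 1 ->
  (forall s, 0 <= s <= 1 -> Rabs (f s) <= M) -> Rabs (RInt f 0 t) <= M.
Proof.
intros Hf Ht HM.
apply Rle_trans with ((t - 0) * M).
- apply abs_RInt_le_const; [lra | |].
  + apply (ex_RInt_continuous f); auto.
  + intros s Hs; apply HM; lra.
- specialize (HM 0 ltac:(lra)); pose proof (Rabs_pos (f 0)); nra.
Qed.

Lemma RInt_diff_bound01 (f g : R -> R) (M t : R) :
  (forall s, continuous f s) -> (forall s, continuous g s) -> 0 <= t <= 1 ->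
  (forall s, 0 <= s <= 1 -> Rabs (f s - g s) <= M) ->
  Rabs (RInt f 0 t - RInt g 0 t) <= M.
Proof.
intros Hf Hg Ht HM.
replace (RInt f 0 t - RInt g 0 t) with (RInt (fun s => minus (f s) (g s)) 0 t).
- apply RInt_bound01; auto.
  intros s; apply (continuous_minus f g); auto.
- apply (RInt_minus f g); [apply (ex_RInt_continuous f) | apply (ex_RInt_continuous g)];
    auto.
Qed.

(** Picard iteration on the ball of radius [Rabs w0] about [w0]. The right-hand side has no linear
    term, so on this ball it is of order [w0 ^ 2]; this gives at once the invariance of the ball and
    the quadratic estimate. *)
Lemma small_solution (q r : R -> R) :
  (forall t, continuous q t) -> (forall t, continuous r t) ->
  exists C del, 0 < C /\ 0 < del /\ forall w0, Rabs w0 <= del ->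
    exists w, w 0 = w0 /\
      (forall t, 0 <= t <= 1 -> is_derive w t (q t * w t ^ 2 + r t * w t ^ 3)) /\
      (forall t, 0 <= t <= 1 -> Rabs (w t - w0) <= C * w0 ^ 2).
Proof.
intros Hq Hr.
destruct (cont01_bounded q) as [M1 [M1p HM1]]; [intros t _; apply Hq|].
destruct (cont01_bounded r) as [M2 [M2p HM2]]; [intros t _; apply Hr|].
set (M := M1 + M2).
(* With [a = Rabs w0 <= 1] and [Rabs y <= 2 * a], the right-hand side is at most
   [(4 * M1 + 8 * M2) * a ^ 2] and its Lipschitz constant at most [4 * M1 * a + 12 * M2 * a]; the
   second bound on [a] makes the latter at most 1/2. *)
exists (12 * M), (Rmin 1 (/ (32 * M))).
assert (Mp : 0 < M) by (unfold M; lra).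
split; [lra|]; split; [apply Rmin_pos; [lra | apply Rinv_0_lt_compat; lra]|].
intros w0 Hw0.
set (a := Rabs w0); fold a in Hw0.
assert (a0 : 0 <= a) by apply Rabs_pos.
assert (a1 : a <= 1) by (apply Rle_trans with (1 := Hw0), Rmin_l).
assert (aM : 32 * M * a <= 1).
{ apply Rle_trans with (32 * M * / (32 * M)).
  - apply Rmult_le_compat_l; [lra|].
    apply Rle_trans with (1 := Hw0), Rmin_r.
  - rewrite Rinv_r; lra. }
set (G := fun (y : R -> R) s => q s * y s ^ 2 + r s * y s ^ 3).
assert (HG : forall y, (forall t, continuous y t) -> forall t, continuous (G y) t).
{ intros y Hy t; unfold G.
  apply (continuous_plus (fun s => q s * y s ^ 2) (fun s => r s * y s ^ 3)).
  - apply (continuous_mult q (fun s => y s ^ 2)); auto.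
    apply (continuous_mult y (fun s => y s * 1)); auto.
    apply (continuous_mult y (fun s => 1)); auto; apply continuous_const.
  - apply (continuous_mult r (fun s => y s ^ 3)); auto.
    apply (continuous_mult y (fun s => y s * (y s * 1))); auto.
    apply (continuous_mult y (fun s => y s * 1)); auto.
    apply (continuous_mult y (fun s => 1)); auto; apply continuous_const. }
assert (Hy2 : forall y : R, Rabs (y - w0) <= a -> Rabs y <= 2 * a).
{ intros y Hy; replace y with ((y - w0) + w0) by ring.
  apply Rle_trans with (1 := Rabs_triang _ _); fold a; lra. }
assert (HGb : forall (y : R -> R) s, Rabs (y s - w0) <= a -> 0 <= s <= 1 ->
          Rabs (G y s) <= 12 * M * w0 ^ 2).
{ intros y s Hy Hs; apply Hy2 in Hy; unfold G.
  apply Rle_trans with (1 := Rabs_triang _ _).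
  rewrite !Rabs_mult, <- !RPow_abs.
  specialize (HM1 s Hs); specialize (HM2 s Hs).
  replace (w0 ^ 2) with (a ^ 2) by (unfold a; rewrite RPow_abs, Rabs_pos_eq; auto using pow2_ge_0).
  pose proof (Rabs_pos (y s)) as Yp.
  assert (Y2 : 0 <= Rabs (y s) ^ 2 <= 4 * a ^ 2) by (split; nra).
  assert (Y3 : 0 <= Rabs (y s) ^ 3 <= 8 * a ^ 2).
  { split; [apply pow_le, Yp|].
    replace (Rabs (y s) ^ 3) with (Rabs (y s) * Rabs (y s) ^ 2) by ring.
    apply Rle_trans with ((2 * a) * (4 * a ^ 2)); [apply Rmult_le_compat; lra|].
    pose proof (pow2_ge_0 a); nra. }
  pose proof (Rabs_pos (q s)); pose proof (Rabs_pos (r s)).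
  assert (Rabs (q s) * Rabs (y s) ^ 2 <= M1 * (4 * a ^ 2))
    by (apply Rmult_le_compat; lra).
  assert (Rabs (r s) * Rabs (y s) ^ 3 <= M2 * (8 * a ^ 2))
    by (apply Rmult_le_compat; lra).
  unfold M; pose proof (pow2_ge_0 a); nra. }
assert (HGd : forall (y z : R -> R) d s, Rabs (y s - w0) <= a -> Rabs (z s - w0) <= a ->
          Rabs (y s - z s) <= d -> 0 <= s <= 1 -> Rabs (G y s - G z s) <= d / 2).
{ intros y z d s Hy Hz Hd Hs; apply Hy2 in Hy; apply Hy2 in Hz; unfold G.
  specialize (HM1 s Hs); specialize (HM2 s Hs).
  replace (q s * y s ^ 2 + r s * y s ^ 3 - (q s * z s ^ 2 + r s * z s ^ 3))
    with ((y s - z s) * (q s * (y s + z s) + r s * (y s * y s + y s * z s + z s * z s)))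
    by ring.
  assert (B1 : Rabs (y s + z s) <= 4 * a)
    by (apply Rle_trans with (1 := Rabs_triang _ _); lra).
  assert (B2 : Rabs (y s * y s + y s * z s + z s * z s) <= 12 * a).
  { apply Rle_trans with (1 := Rabs_triang _ _).
    apply Rle_trans with (Rabs (y s) * Rabs (y s) + Rabs (y s) * Rabs (z s)
                          + Rabs (z s) * Rabs (z s)).
    - rewrite <- !Rabs_mult; apply Rplus_le_compat_r, Rabs_triang.
    - pose proof (Rabs_pos (y s)); pose proof (Rabs_pos (z s)); nra. }
  rewrite Rabs_mult.
  replace (d / 2) with (d * / 2) by reflexivity.
  apply Rmult_le_compat; try apply Rabs_pos; auto.
  apply Rle_trans with (1 := Rabs_triang _ _); rewrite !Rabs_mult.
  apply Rle_trans with (M1 * (4 * a) + M2 * (12 * a)).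
  - apply Rplus_le_compat; apply Rmult_le_compat; auto using Rabs_pos.
  - unfold M in aM; nra. }
assert (Mw : 12 * M * w0 ^ 2 <= a).
{ replace (w0 ^ 2) with (a ^ 2) by (unfold a; rewrite RPow_abs, Rabs_pos_eq; auto using pow2_ge_0).
  nra. }
destruct (contraction_fixed_point (fun y t => w0 + RInt (G y) 0 (clamp t)) w0 a)
  as [y [[yc yb] Hy]]; auto.
- intros y [yc yb]; split; intros t.
  + apply (continuous_plus (fun _ => w0) (fun t => RInt (G y) 0 (clamp t)));
      [apply continuous_const | apply continuous_RInt_clamp; auto].
  + rewrite Rplus_minus_l.
    apply RInt_bound01; auto; [apply clamp_range|].
    intros s Hs; apply Rle_trans with (1 := HGb y s (yb s) Hs), Mw.
- intros y z d [yc yb] [zc zb] Hd Hyz t.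
  rewrite Rminus_plus_l_l.
  apply RInt_diff_bound01; auto using clamp_range.
- assert (Ew : forall t, 0 <= t <= 1 -> w0 + RInt (G y) 0 t = y t).
  { intros t Ht; rewrite <- Hy, clamp_id; auto. }
  (* The fixed point [y] is constant outside [0,1]; the integral without [clamp] agrees with it on
     [0,1] and has two-sided derivatives at the ends. *)
  exists (fun t => w0 + RInt (G y) 0 t); split; [|split].
  + rewrite (RInt_point 0 (G y)); apply Rplus_0_r.
  + intros t Ht; rewrite Ew by exact Ht.
    replace (q t * y t ^ 2 + r t * y t ^ 3) with (0 + G y t) by (unfold G; ring).
    apply (is_derive_plus (fun _ => w0) (RInt (G y) 0)).
    * apply (is_derive_const w0).
    * apply derive_RInt_continuous; auto.
  + intros t Ht.
    rewrite Rplus_minus_l.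
    apply RInt_bound01; auto.
Qed.

(** * The Poincare map *)

Lemma continuous_pow (f : R -> R) (n : nat) (x : R) :
  continuous f x -> continuous (fun t => f t ^ n) x.
Proof.
intros H; induction n; [apply continuous_const|].
apply (continuous_mult f (fun t => f t ^ n)); auto.
Qed.

Lemma continuous_div (f g : R -> R) (x : R) :
  continuous f x -> continuous g x -> g x <> 0 ->
  continuous (fun t => f t / g t) x.
Proof.
intros Hf Hg H.
apply (continuous_mult f (fun t => / g t)); auto.
apply continuous_Rinv_comp; auto.
Qed.

Ltac continuity :=
  match goal with
  | |- continuous (fun t => @?f t + @?g t) ?x => apply (continuous_plus f g x); continuity
  | |- continuous (fun t => @?f t - @?g t) ?x => apply (continuous_minus f g x); continuity
  | |- continuous (fun t => - @?f t) ?x => apply (continuous_opp f x); continuity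
  | |- continuous (fun t => @?f t * @?g t) ?x => apply (continuous_mult f g x); continuity
  | |- continuous (fun t => @?f t / @?g t) ?x => apply (continuous_div f g x); continuity
  | |- continuous (fun t => @?f t ^ ?n) ?x => apply (continuous_pow f n x); continuity
  | |- continuous (fun t => exp (@?f t)) ?x => apply (continuous_exp_comp f x); continuity
  | |- continuous _ _ => first [apply continuous_const | apply continuous_id | solve [auto] | idtac]
  | _ => idtac
  end.

(** For [coefA] coefficients this is convertible to [is_solution]; arbitrary [A] and [B] keep the
    trigonometry out of the general arguments. *)
Definition solves (A B x : R -> R) : Prop :=
  forall t, 0 <= t <= 1 -> is_derive x t (A t * x t ^ 3 + B t * x t ^ 2).

Lemma solves_cont01 (A B x : R -> R) : solves A B x -> cont01 x.
Proof. intros H t Ht; eapply is_derive_continuous, H, Ht. Qed.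

Lemma solution_unique (A B x y : R -> R) (s t : R) :
  (forall t, continuous A t) -> (forall t, continuous B t) ->
  solves A B x -> solves A B y -> 0 <= s <= 1 -> 0 <= t <= 1 ->
  x s = y s -> x t = y t.
Proof.
intros HA HB Hx Hy Hs Ht E.
pose proof (solves_cont01 _ _ _ Hx) as Cx; pose proof (solves_cont01 _ _ _ Hy) as Cy.
apply Rminus_diag_uniq.
apply (linear_ode_zero (fun t => x t - y t)
  (fun t => A t * (x t ^ 2 + x t * y t + y t ^ 2) + B t * (x t + y t)) s t); auto.
- intros r Hr; specialize (Cx r Hr); specialize (Cy r Hr); continuity.
- intros r Hr; specialize (Hx r Hr); specialize (Hy r Hr).
  auto_derive.
  + repeat split; eexists; eassumption.
  + rewrite_derive Hx; rewrite_derive Hy; ring.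
- rewrite E; ring.
Qed.

Lemma zero_solves (A B : R -> R) : solves A B (fun _ => 0).
Proof.
intros t _; replace (_ + _) with 0 by ring; exact (is_derive_const 0 t).
Qed.

Lemma solution_nonzero (A B x : R -> R) (s t : R) :
  (forall t, continuous A t) -> (forall t, continuous B t) -> solves A B x ->
  0 <= s <= 1 -> 0 <= t <= 1 -> x s <> 0 -> x t <> 0.
Proof.
intros HA HB Hx Hs Ht H H0; apply H.
apply (solution_unique A B x (fun _ => 0) t s); auto using zero_solves.
Qed.

Lemma quadratic_error_derive (f : R -> R) (x l K del : R) :
  0 < del ->
  (forall h, Rabs h <= del -> Rabs (f (x + h) - f x - l * h) <= K * h ^ 2) ->
  is_derive f x l.
Proof.
intros Hdel H; apply is_derive_Reals; intros eps Heps.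
set (K' := Rabs K + 1).
assert (HK : 0 < K') by (unfold K'; pose proof (Rabs_pos K); lra).
assert (Hd : 0 < Rmin del (eps / K')).
{ apply Rmin_pos; [lra | apply Rdiv_lt_0_compat; lra]. }
exists (mkposreal _ Hd); intros h h0 Hh; simpl in Hh.
pose proof (Rmin_l del (eps / K')); pose proof (Rmin_r del (eps / K')).
specialize (H h ltac:(lra)).
assert (Hp : 0 < Rabs h) by (apply Rabs_pos_lt, h0).
replace ((f (x + h) - f x) / h - l) with ((f (x + h) - f x - l * h) / h) by (field; auto).
unfold Rdiv; rewrite Rabs_mult, Rabs_inv.
apply Rmult_lt_reg_r with (Rabs h); [exact Hp|].
rewrite Rmult_assoc, Rinv_l, Rmult_1_r by lra.
apply Rle_lt_trans with (1 := H).
replace (h ^ 2) with (Rabs h * Rabs h)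
  by (rewrite <- Rabs_mult, Rabs_pos_eq; [ring | nra]).
apply Rle_lt_trans with (K' * Rabs h * Rabs h).
- pose proof (Rle_abs K); unfold K'; nra.
- apply Rmult_lt_compat_r; [exact Hp|].
  apply Rlt_le_trans with (K' * (eps / K')).
  + apply Rmult_lt_compat_l; lra.
  + right; field; lra.
Qed.

Lemma continuous_coefA (a0 a1 a2 t : R) : continuous (coefA a0 a1 a2) t.
Proof. apply (ex_derive_continuous (coefA a0 a1 a2)); unfold coefA; auto_derive; auto. Qed.

#[local] Hint Resolve continuous_coefA : core.

(** The value selected by [epsilon] is the end value of some solution from [x 0], which by
    uniqueness agrees with [x] on [0,1]. *)
Lemma poincare_solution (a0 a1 a2 b0 b1 b2 : R) (x : R -> R) :
  let A := coefA a0 a1 a2 in let B := coefA b0 b1 b2 in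
  solves A B x -> poincare a0 a1 a2 b0 b1 b2 (x 0) = x 1.
Proof.
intros A B Hx.
destruct (epsilon_spec (inhabits 0)
  (fun y => exists z, is_solution a0 a1 a2 b0 b1 b2 z /\ z 0 = x 0 /\ z 1 = y))
  as [z [Hz [E0 E1]]].
{ exists (x 1), x; auto. }
unfold poincare; rewrite <- E1.
apply (solution_unique A B z x 0 1); unfold A, B; auto; lra.
Qed.

(* The perturbed solution is sought as [x + exp(P) w], which removes the linear
   term of the equation for [w]. *)
Lemma poincare_derive (a0 a1 a2 b0 b1 b2 : R) (x : R -> R) (l : R) :
  let A := coefA a0 a1 a2 in let B := coefA b0 b1 b2 in
  solves A B x -> is_RInt (fun t => 3 * A t * x t ^ 2 + 2 * B t * x t) 0 1 l ->
  is_derive (poincare a0 a1 a2 b0 b1 b2) (x 0) (exp l).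
Proof.
intros A B Hx Hl; pose proof (solves_cont01 _ _ _ Hx) as Cx.
assert (CA : forall t, continuous A t) by apply continuous_coefA.
assert (CB : forall t, continuous B t) by apply continuous_coefA.
set (p := fun t => 3 * A t * x t ^ 2 + 2 * B t * x t) in Hl.
assert (Cp : cont01 p).
{ intros t Ht; specialize (Cx t Ht); unfold p; continuity. }
destruct (antiderivative01 p Cp) as [P [P0 [dP IP]]].
assert (El : P 1 = l).
{ rewrite <- (is_RInt_unique _ _ _ _ IP); apply (is_RInt_unique p), Hl. }
assert (CP : cont01 P) by (intros t Ht; eapply is_derive_continuous, dP, Ht).
(* [q] and [r] are the coefficients of degree two and three in the expansion of the field at
   [x + exp(P) w], divided by [exp(P)]. *)
set (q := fun t => exp (P t) * (3 * A t * x t + B t)).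
set (r := fun t => exp (P t) ^ 2 * A t).
assert (Cq : cont01 q).
{ intros t Ht; specialize (Cx t Ht); specialize (CP t Ht); unfold q; continuity. }
assert (Cr : cont01 r).
{ intros t Ht; specialize (CP t Ht); unfold r; continuity. }
destruct (small_solution (fun t => q (clamp t)) (fun t => r (clamp t)))
  as [C [del [_ [Hdel H]]]]; try (intros t; apply continuous_comp_clamp; auto).
apply (quadratic_error_derive _ _ _ (exp l * C) del Hdel); intros h Hh.
destruct (H h Hh) as [w [w0 [dw Hw]]].
set (y := fun t => x t + exp (P t) * w t).
assert (Hy : solves A B y).
{ intros t Ht.
  specialize (Hx t Ht); specialize (dP t Ht); specialize (dw t Ht).
  cbv beta in dw; rewrite clamp_id in dw by exact Ht.
  unfold y; auto_derive.
  - repeat split; eexists; eassumption.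
  - rewrite_derive Hx; rewrite_derive dP; rewrite_derive dw.
    unfold q, r, p; ring. }
replace (x 0 + h) with (y 0) by (unfold y; rewrite P0, exp_0, w0; ring).
rewrite (poincare_solution _ _ _ _ _ _ y), (poincare_solution _ _ _ _ _ _ x) by assumption.
unfold y; rewrite El.
replace (x 1 + exp l * w 1 - x 1 - exp l * h) with (exp l * (w 1 - h)) by ring.
pose proof (exp_pos l).
rewrite Rabs_mult, (Rabs_pos_eq (exp l)), Rmult_assoc by lra.
apply Rmult_le_compat_l; [lra|]; apply Hw; lra.
Qed.

Lemma hyperbolic_integral (a0 a1 a2 b0 b1 b2 : R) (x : R -> R) (l : R) :
  let A := coefA a0 a1 a2 in let B := coefA b0 b1 b2 in
  solves A B x -> is_RInt (fun t => 3 * A t * x t ^ 2 + 2 * B t * x t) 0 1 l ->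
  l <> 0 -> hyperbolic a0 a1 a2 b0 b1 b2 (x 0).
Proof.
intros A B Hx Hl H; exists (exp l); split; [apply poincare_derive; auto|].
rewrite <- exp_0; intros E; apply H, exp_inv, E.
Qed.

Lemma integral_along (A B x f : R -> R) :
  (forall t, continuous A t) -> (forall t, continuous B t) -> solves A B x ->
  (forall t, 0 <= t <= 1 -> continuous f (x t)) ->
  is_RInt (fun t => (A t * x t ^ 3 + B t * x t ^ 2) * f (x t)) 0 1 (RInt f (x 0) (x 1)).
Proof.
intros HA HB Hx Hf; pose proof (solves_cont01 _ _ _ Hx) as Cx.
apply (is_RInt_comp f x (fun t => A t * x t ^ 3 + B t * x t ^ 2) 0 1);
  rewrite Rmin_left, Rmax_right by lra; auto.
intros t Ht; split; [apply Hx, Ht|].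
specialize (Cx t Ht); continuity.
Qed.

(** The substitution [v = x t] turns the integral into that of [f] from [x 0] to [x 1], a degenerate
    interval. *)
Lemma integral_periodic (A B x f : R -> R) :
  (forall t, continuous A t) -> (forall t, continuous B t) -> solves A B x ->
  x 0 = x 1 -> (forall t, 0 <= t <= 1 -> continuous f (x t)) ->
  is_RInt (fun t => (A t * x t ^ 3 + B t * x t ^ 2) * f (x t)) 0 1 0.
Proof.
intros HA HB Hx E Hf.
replace 0 with (RInt f (x 0) (x 1)) at 2; [apply integral_along; auto|].
rewrite E; apply (RInt_point (x 1) f).
Qed.

(** * The sign criterion and the separable case *)

Lemma intermediate_value01 (g : R -> R) (s t v : R) :
  cont01 g -> 0 <= s <= 1 -> 0 <= t <= 1 ->
  Rmin (g s) (g t) <= v <= Rmax (g s) (g t) -> exists r, 0 <= r <= 1 /\ g r = v.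
Proof.
intros Hg Hs Ht Hv.
destruct (IVT_gen (fun t => g (clamp t)) s t v) as [r [_ E]].
- intros r; apply continuity_pt_filterlim.
  apply (continuous_comp_clamp g), Hg.
- rewrite !clamp_id; auto.
- exists (clamp r); split; [apply clamp_range | exact E].
Qed.

Lemma nonvanishing_same_sign (g : R -> R) (s t : R) :
  cont01 g -> (forall r, 0 <= r <= 1 -> g r <> 0) ->
  0 <= s <= 1 -> 0 <= t <= 1 -> 0 < g s * g t.
Proof.
intros Hg H Hs Ht.
destruct (Rlt_le_dec 0 (g s * g t)) as [|N]; [assumption|exfalso].
destruct (intermediate_value01 g s t 0) as [r [Hr E]]; auto.
- unfold Rmin, Rmax; destruct (Rle_dec (g s) (g t)); nra.
- apply (H r Hr E).
Qed.

(** By the intermediate value theorem [g] keeps the sign of [g t0], so multiplying by the constant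
    [g t0] makes the integrand nonnegative, and positive at [t0]. *)
Lemma weighted_integral_neq0 (D g : R -> R) (l t0 : R) :
  cont01 D -> cont01 g -> (forall t, 0 <= t <= 1 -> 0 <= D t) ->
  (forall t, 0 <= t <= 1 -> g t <> 0) -> 0 < t0 < 1 -> D t0 <> 0 ->
  is_RInt (fun t => D t * g t) 0 1 l -> l <> 0.
Proof.
intros CD Cg HD Hg Ht0 H0 HI ->; apply H0.
apply Rmult_eq_reg_r with (g t0 * g t0).
- rewrite Rmult_0_l, <- Rmult_assoc, Rmult_comm.
  apply (integral_nonneg_eq0 (fun t => g t0 * (D t * g t))); auto.
  + intros t Ht; specialize (CD t Ht); specialize (Cg t Ht); continuity.
  + intros t Ht.
    assert (H := nonvanishing_same_sign g t t0 Cg Hg Ht ltac:(lra)).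
    specialize (HD t Ht); nra.
  + replace 0 with (g t0 * 0) at 2 by ring.
    apply (is_RInt_scal (fun t => D t * g t)), HI.
- specialize (Hg t0 ltac:(lra)); nra.
Qed.

(* If [p A + q B >= 0], the vector field crosses the level [p - q x = 0] in one
   direction only. *)
Lemma criterion_nonvanishing (A B x : R -> R) (p q t0 : R) :
  (forall t, continuous A t) -> (forall t, continuous B t) ->
  (forall t, 0 <= t <= 1 -> 0 <= p * A t + q * B t) ->
  0 < t0 < 1 -> p * A t0 + q * B t0 <> 0 ->
  solves A B x -> x 0 = x 1 -> x 0 <> 0 ->
  forall t, 0 <= t <= 1 -> p - q * x t <> 0.
Proof.
intros HA HB HD Ht0 D0 Hx Hp Hn t Ht E; apply D0.
pose proof (solves_cont01 _ _ _ Hx) as Cx.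
(* The identity behind the choice: with [w = p - q x] and [D = p A + q B], one has
   [w' = A x^2 w - x^2 D]. *)
destruct (periodic_touching_zero (fun t => p - q * x t) (fun t => A t * x t ^ 2)
  (fun t => x t ^ 2 * (p * A t + q * B t)) t) as [_ H]; auto.
- intros s Hs; specialize (Cx s Hs); continuity.
- intros s Hs; specialize (Hx s Hs); auto_derive.
  + repeat split; eexists; eassumption.
  + rewrite_derive Hx; ring.
- intros s Hs; apply Rmult_le_pos; [apply pow2_ge_0 | apply HD, Hs].
- rewrite Hp; reflexivity.
- specialize (H t0 Ht0); apply Rmult_integral in H; destruct H as [H|H]; auto.
  exfalso; assert (Hx0 : x t0 <> 0)
    by (apply (solution_nonzero A B x 0 t0); auto; lra).
  apply (pow_nonzero _ 2 Hx0 H).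
Qed.

Lemma criterion_unique (A B x y : R -> R) (p q t0 : R) :
  (forall t, continuous A t) -> (forall t, continuous B t) ->
  (forall t, 0 <= t <= 1 -> 0 <= p * A t + q * B t) ->
  0 < t0 < 1 -> p * A t0 + q * B t0 <> 0 ->
  solves A B x -> x 0 = x 1 -> x 0 <> 0 ->
  solves A B y -> y 0 = y 1 -> y 0 <> 0 -> x 0 = y 0.
Proof.
intros HA HB HD Ht0 D0 Hx Ex Nx Hy Ey Ny.
destruct (Req_dec (x 0) (y 0)) as [|N]; [assumption|exfalso].
pose proof (solves_cont01 _ _ _ Hx) as Cx; pose proof (solves_cont01 _ _ _ Hy) as Cy.
assert (I : forall z, solves A B z -> z 0 = z 1 -> z 0 <> 0 ->
  is_RInt (fun t => (A t * z t + B t) / (p - q * z t)) 0 1 0).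
{ intros z Hz Ez Nz.
  assert (N1 : forall t, 0 <= t <= 1 -> z t <> 0)
    by (intros t Ht; apply (solution_nonzero A B z 0 t); auto; lra).
  assert (N2 := criterion_nonvanishing A B z p q t0 HA HB HD Ht0 D0 Hz Ez Nz).
  apply is_RInt_ext01 with
    (fun t => (A t * z t ^ 3 + B t * z t ^ 2) * (1 / (z t ^ 2 * (p - q * z t)))).
  - intros t Ht; field; split;
      [apply N2 | apply N1]; lra.
  - apply (integral_periodic A B z (fun v => 1 / (v ^ 2 * (p - q * v)))); auto.
    intros t Ht; continuity.
    apply Rmult_integral_contrapositive_currified; [apply pow_nonzero|]; auto. }
assert (Nx' := criterion_nonvanishing A B x p q t0 HA HB HD Ht0 D0 Hx Ex Nx).
assert (Ny' := criterion_nonvanishing A B y p q t0 HA HB HD Ht0 D0 Hy Ey Ny).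
(* The weight never vanishes: distinct solutions never meet, and [p - q x], [p - q y] have no
   zeros. *)
apply (weighted_integral_neq0 (fun t => p * A t + q * B t)
  (fun t => (x t - y t) / ((p - q * x t) * (p - q * y t))) 0 t0); auto.
- intros t _; continuity.
- intros t Ht; specialize (Cx t Ht); specialize (Cy t Ht); continuity.
  apply Rmult_integral_contrapositive_currified; auto.
- intros t Ht; apply Rmult_integral_contrapositive_currified.
  + intros E; apply Rminus_diag_uniq in E; apply N.
    apply (solution_unique A B x y t 0); auto; lra.
  + apply Rinv_neq_0_compat, Rmult_integral_contrapositive_currified; auto.
- apply is_RInt_ext01 with
    (fun t => (A t * x t + B t) / (p - q * x t) - (A t * y t + B t) / (p - q * y t)).
  + intros t Ht; field; split; [apply Ny' | apply Nx']; lra.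
  + rewrite <- (Rminus_diag 0) at 2; apply is_RInt_Rminus; apply I; auto.
Qed.

(* Subtracting the logarithmic derivative of [x^2 (p - q x)], which integrates to
   zero along a periodic orbit, leaves [x^2 (p A + q B) / (p - q x)]. *)
Lemma criterion_hyperbolic (A B x : R -> R) (p q t0 : R) :
  (forall t, continuous A t) -> (forall t, continuous B t) ->
  (forall t, 0 <= t <= 1 -> 0 <= p * A t + q * B t) ->
  0 < t0 < 1 -> p * A t0 + q * B t0 <> 0 ->
  solves A B x -> x 0 = x 1 -> x 0 <> 0 ->
  exists l, l <> 0 /\ is_RInt (fun t => 3 * A t * x t ^ 2 + 2 * B t * x t) 0 1 l.
Proof.
intros HA HB HD Ht0 D0 Hx Ex Nx.
pose proof (solves_cont01 _ _ _ Hx) as Cx.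
assert (N1 : forall t, 0 <= t <= 1 -> x t <> 0)
  by (intros t Ht; apply (solution_nonzero A B x 0 t); auto; lra).
assert (N2 := criterion_nonvanishing A B x p q t0 HA HB HD Ht0 D0 Hx Ex Nx).
destruct (antiderivative01 (fun t => 3 * A t * x t ^ 2 + 2 * B t * x t)) as [L [_ [_ HL]]].
{ intros t Ht; specialize (Cx t Ht); continuity. }
exists (L 1); split; [|exact HL].
apply (weighted_integral_neq0 (fun t => p * A t + q * B t)
  (fun t => x t ^ 2 / (p - q * x t)) (L 1) t0); auto.
- intros t _; continuity.
- intros t Ht; specialize (Cx t Ht); continuity; auto.
- intros t Ht; apply Rmult_integral_contrapositive_currified;
    [apply pow_nonzero | apply Rinv_neq_0_compat]; auto.
- set (f := fun v => (2 * p * v - 3 * q * v ^ 2) / (v ^ 2 * (p - q * v))).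
  apply is_RInt_ext01 with
    (fun t => 3 * A t * x t ^ 2 + 2 * B t * x t
              - (A t * x t ^ 3 + B t * x t ^ 2) * f (x t)).
  + intros t Ht; unfold f; field; split; [apply N2 | apply N1]; lra.
  + rewrite <- (Rminus_0_r (L 1)); apply is_RInt_Rminus; [exact HL|].
    apply (integral_periodic A B x f); auto.
    intros t Ht; unfold f; continuity.
    apply Rmult_integral_contrapositive_currified; [apply pow_nonzero|]; auto.
Qed.

(** Here the equation reads [x' = - C x^2 (p - q x)], so [p - q x] solves a homogeneous linear
    equation along [x]. *)
Lemma separable_level_const (A B C x : R -> R) (p q : R) :
  (forall t, continuous C t) ->
  (forall t, A t = q * C t) -> (forall t, B t = - p * C t) ->
  solves A B x -> forall s t, 0 <= s <= 1 -> 0 <= t <= 1 ->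
  p - q * x s = 0 -> p - q * x t = 0.
Proof.
intros HC HA HB Hx s t Hs Ht.
pose proof (solves_cont01 _ _ _ Hx) as Cx.
apply (linear_ode_zero (fun t => p - q * x t) (fun t => q * C t * x t ^ 2) s t); auto.
- intros r Hr; specialize (Cx r Hr); continuity.
- intros r Hr; specialize (Hx r Hr); auto_derive.
  + repeat split; eexists; eassumption.
  + rewrite_derive Hx; rewrite HA, HB; ring.
Qed.

Lemma separable_equilibrium (A B C x : R -> R) (p q : R) :
  (forall t, continuous C t) ->
  (forall t, A t = q * C t) -> (forall t, B t = - p * C t) ->
  solves A B x -> p - q * x 0 = 0 -> forall t, 0 <= t <= 1 -> x t = x 0.
Proof.
intros HC HA HB Hx E t Ht.
apply (derive_zero_constant x 0 t); try lra.
intros r Hr; replace 0 with (A r * x r ^ 3 + B r * x r ^ 2); [apply Hx, Hr|].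
rewrite HA, HB.
replace (q * C r * x r ^ 3 + - p * C r * x r ^ 2)
  with (- (C r * x r ^ 2 * (p - q * x r))) by ring.
rewrite (separable_level_const A B C x p q HC HA HB Hx 0 r); auto; lra || ring.
Qed.

(** Separation of variables; the denominator stays nonzero because both its zero levels are
    invariant. *)
Lemma separable_integral (A B C x : R -> R) (p q : R) :
  (forall t, continuous C t) ->
  (forall t, A t = q * C t) -> (forall t, B t = - p * C t) ->
  solves A B x -> x 0 <> 0 -> p - q * x 0 <> 0 ->
  (forall t, 0 <= t <= 1 -> x t ^ 2 * (p - q * x t) <> 0) /\
  is_RInt (fun t => - C t) 0 1 (RInt (fun v => 1 / (v ^ 2 * (p - q * v))) (x 0) (x 1)).
Proof.
intros HC HA HB Hx N1 N2.
assert (CA : forall t, continuous A t).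
{ intros t; apply (continuous_ext (fun t => q * C t)); [|continuity].
  intros s; symmetry; apply HA. }
assert (CB : forall t, continuous B t).
{ intros t; apply (continuous_ext (fun t => - p * C t)); [|continuity].
  intros s; symmetry; apply HB. }
assert (N1' : forall t, 0 <= t <= 1 -> x t <> 0).
{ intros t Ht; apply (solution_nonzero A B x 0 t); auto; lra. }
assert (N2' : forall t, 0 <= t <= 1 -> p - q * x t <> 0).
{ intros t Ht E; apply N2.
  apply (separable_level_const A B C x p q HC HA HB Hx t 0); auto; lra. }
assert (N : forall t, 0 <= t <= 1 -> x t ^ 2 * (p - q * x t) <> 0).
{ intros t Ht; apply Rmult_integral_contrapositive_currified; [apply pow_nonzero|]; auto. }
split; [exact N|].
apply is_RInt_ext01 with
  (fun t => (A t * x t ^ 3 + B t * x t ^ 2) * (1 / (x t ^ 2 * (p - q * x t)))).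
- intros t Ht; rewrite HA, HB; field; split; [apply N2' | apply N1']; lra.
- apply (integral_along A B x (fun v => 1 / (v ^ 2 * (p - q * v)))); auto.
  intros t Ht; continuity; auto.
Qed.

(** Off the invariant levels, the separated integrand has zero integral between [x 0] and [x 1] and
    constant sign there, so the two ends coincide. *)
Lemma separable_periodic (A B C x : R -> R) (p q : R) :
  (forall t, continuous C t) ->
  (forall t, A t = q * C t) -> (forall t, B t = - p * C t) ->
  solves A B x -> is_RInt C 0 1 0 -> x 1 = x 0.
Proof.
intros HC HA HB Hx IC.
pose proof (solves_cont01 _ _ _ Hx) as Cx.
destruct (Req_dec (x 0) 0) as [E|N1].
{ rewrite E.
  apply (linear_ode_zero x (fun t => A t * x t ^ 2 + B t * x t) 0 1); auto; try lra.
  - intros t Ht; specialize (Cx t Ht).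
    apply (continuous_ext (fun t => q * C t * x t ^ 2 + - p * C t * x t)); [|continuity].
    intros s; rewrite HA, HB; reflexivity.
  - intros t Ht; replace ((A t * x t ^ 2 + B t * x t) * x t)
      with (A t * x t ^ 3 + B t * x t ^ 2) by ring; apply Hx, Ht. }
destruct (Req_dec (p - q * x 0) 0) as [E|N2].
{ apply (separable_equilibrium A B C x p q HC HA HB Hx E); lra. }
destruct (separable_integral A B C x p q HC HA HB Hx N1 N2) as [N I].
set (f := fun v => 1 / (v ^ 2 * (p - q * v))) in I.
assert (I0 : RInt f (x 0) (x 1) = 0).
{ rewrite <- (is_RInt_unique _ _ _ _ I).
  apply (is_RInt_unique (fun t => - C t)); replace 0 with (- 0) at 2 by ring.
  apply (is_RInt_opp C), IC. }
(* Every [v] between the ends is a value of [x], so what holds along the solution holds on the whole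
   interval of integration. *)
assert (Hpos : forall v, Rmin (x 0) (x 1) <= v <= Rmax (x 0) (x 1) ->
  v ^ 2 * (p - q * v) <> 0 /\ 0 < f (x 0) * f v).
{ intros v Hv.
  destruct (intermediate_value01 x 0 1 v) as [r [Hr <-]]; auto; try lra.
  split; [apply N, Hr|].
  apply (nonvanishing_same_sign (fun t => f (x t)) 0 r); auto; try lra.
  - intros t Ht; specialize (Cx t Ht); unfold f; continuity; auto.
  - intros t Ht; unfold f; apply Rmult_integral_contrapositive_currified; [lra|].
    apply Rinv_neq_0_compat, N, Ht. }
assert (Hcont : forall v, Rmin (x 0) (x 1) <= v <= Rmax (x 0) (x 1) -> continuous f v).
{ intros v Hv; unfold f; continuity; apply Hpos, Hv. }
assert (Iscal : RInt (fun v => f (x 0) * f v) (x 0) (x 1) = 0).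
{ transitivity (f (x 0) * RInt f (x 0) (x 1)); [|rewrite I0; apply Rmult_0_r].
  apply (RInt_scal f); apply (ex_RInt_continuous f), Hcont. }
destruct (Rtotal_order (x 0) (x 1)) as [L|[E|L]]; [exfalso|auto|exfalso].
- rewrite Rmin_left, Rmax_right in * by lra.
  assert (G := RInt_gt_0 (fun v => f (x 0) * f v) (x 0) (x 1) L).
  rewrite Iscal in G; apply (Rlt_irrefl 0), G.
  + intros v Hv; apply Hpos; lra.
  + intros v Hv; specialize (Hcont v Hv); continuity.
- rewrite Rmin_right, Rmax_left in * by lra.
  assert (G := RInt_gt_0 (fun v => f (x 0) * f v) (x 1) (x 0) L).
  rewrite <- (opp_RInt_swap (fun v => f (x 0) * f v)) in G.
  + rewrite Iscal in G; unfold opp in G; simpl in G; rewrite Ropp_0 in G.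
    apply (Rlt_irrefl 0), G.
    * intros v Hv; apply Hpos; lra.
    * intros v Hv; specialize (Hcont v Hv); continuity.
  + apply (ex_RInt_continuous (fun v => f (x 0) * f v)).
    rewrite Rmin_right, Rmax_left by lra.
    intros v Hv; specialize (Hcont v Hv); continuity.
Qed.

(** * Trigonometric coefficients and centers *)

Lemma is_RInt_const01 (c : R) : is_RInt (fun _ => c) 0 1 c.
Proof.
replace c with ((1 - 0) * c) at 1 by ring; exact (is_RInt_const 0 1 c).
Qed.

Lemma integral_bound01 (f : R -> R) (M l : R) :
  is_RInt f 0 1 l -> (forall t, 0 < t < 1 -> Rabs (f t) <= M) -> Rabs l <= M.
Proof.
intros HI HM; apply Rabs_le; split.
- apply (is_RInt_le (fun _ => - M) f 0 1); auto; try lra.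
  + apply is_RInt_const01.
  + intros t Ht; specialize (HM t Ht); apply Rabs_le_between in HM; lra.
- apply (is_RInt_le f (fun _ => M) 0 1); auto; try lra.
  + apply is_RInt_const01.
  + intros t Ht; specialize (HM t Ht); apply Rabs_le_between in HM; lra.
Qed.

(** Serves to read off the successive coefficients of an expansion in the initial value [xi]. *)
Lemma eq0_of_linear_bound (v K d : R) :
  0 < d -> (forall xi, 0 < xi <= d -> Rabs v <= K * xi) -> v = 0.
Proof.
intros Hd H; destruct (Req_dec v 0) as [|N]; [assumption|exfalso].
apply Rabs_pos_lt in N.
assert (HK : 0 < K) by (specialize (H d ltac:(lra)); nra).
assert (Hm : 0 < Rmin d (Rabs v / (2 * K)))
  by (apply Rmin_pos; [lra | apply Rdiv_lt_0_compat; lra]).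
specialize (H _ (conj Hm (Rmin_l _ _))).
assert (K * Rmin d (Rabs v / (2 * K)) <= K * (Rabs v / (2 * K)))
  by (apply Rmult_le_compat_l; [lra | apply Rmin_r]).
replace (K * (Rabs v / (2 * K))) with (Rabs v / 2) in H0 by (field; lra).
lra.
Qed.

(** The constant of integration is chosen so that the primitive vanishes at 0. *)
Definition coefA_primitive (a0 a1 a2 t : R) : R :=
  a0 * t + (a1 * sin (2 * PI * t) + a2 * (1 - cos (2 * PI * t))) / (2 * PI).

Lemma is_derive_coefA_primitive (a0 a1 a2 t : R) :
  is_derive (coefA_primitive a0 a1 a2) t (coefA a0 a1 a2 t).
Proof.
unfold coefA_primitive, coefA; auto_derive; auto.
field; apply PI_neq0.
Qed.

Lemma cos_2PI_1 : cos (2 * PI * 1) = 1.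
Proof. rewrite Rmult_1_r; apply cos_2PI. Qed.

Lemma sin_2PI_1 : sin (2 * PI * 1) = 0.
Proof. rewrite Rmult_1_r; apply sin_2PI. Qed.

Lemma coefA_primitive_0 (a0 a1 a2 : R) : coefA_primitive a0 a1 a2 0 = 0.
Proof.
unfold coefA_primitive; rewrite !Rmult_0_r, sin_0, cos_0; field; apply PI_neq0.
Qed.

Lemma integral_coefA (a0 a1 a2 : R) : is_RInt (coefA a0 a1 a2) 0 1 a0.
Proof.
replace a0 with (coefA_primitive a0 a1 a2 1 - coefA_primitive a0 a1 a2 0) at 2.
- apply integral_derive; [intros; apply is_derive_coefA_primitive | intros t _; auto].
- rewrite coefA_primitive_0; unfold coefA_primitive.
  rewrite sin_2PI_1, cos_2PI_1; field; apply PI_neq0.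
Qed.

(** Among the products of sines and cosines only the two squares have nonzero mean, namely 1/2. *)
Lemma integral_coefA_primitive (a1 a2 b1 b2 : R) :
  is_RInt (fun t => coefA 0 a1 a2 t * coefA_primitive 0 b1 b2 t) 0 1
    ((a2 * b1 - a1 * b2) / (4 * PI)).
Proof.
set (w := 2 * PI).
assert (HP := PI_neq0).
assert (Hw : w <> 0) by (unfold w; lra).
set (F := fun t => ((a1 * b1 - a2 * b2) * sin (w * t) ^ 2 / (2 * w)
  + a2 * b1 * (t / 2 - sin (w * t) * cos (w * t) / (2 * w))
  + a1 * b2 * sin (w * t) / w
  - a1 * b2 * (t / 2 + sin (w * t) * cos (w * t) / (2 * w))
  + a2 * b2 * (1 - cos (w * t)) / w) / w).
replace ((a2 * b1 - a1 * b2) / (4 * PI)) with (F 1 - F 0).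
- apply integral_derive.
  + intros t _; unfold F, coefA_primitive, coefA; fold w; auto_derive; auto.
    pose proof (sin2_cos2 (w * t)) as E; unfold Rsqr in E.
    set (c := cos (w * t)) in *; set (s := sin (w * t)) in *.
    (* The derivative of [F] equals the integrand only modulo [s * s + c * c = 1]; the added term is
       that discrepancy. *)
    match goal with |- _ = ?r =>
      transitivity (r + (a2 * b1 - a1 * b2) / (2 * w) * (1 - (s * s + c * c)))
    end; [field; auto | rewrite E; ring].
  + intros t _; apply (continuous_mult (coefA 0 a1 a2) (coefA_primitive 0 b1 b2)); auto.
    eapply is_derive_continuous, is_derive_coefA_primitive.
- unfold F, w.
  rewrite sin_2PI_1, cos_2PI_1, !Rmult_0_r, sin_0, cos_0; field; auto.
Qed.

(** Dividing by [w^2], the closed solution [w] from a small [xi] satisfies that the integral of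
    [A w + B] is zero. The orders 0, 1 and 2 in [xi] of this identity give the three conditions in
    turn. *)
Lemma center_coefficients (a0 a1 a2 b0 b1 b2 : R) :
  has_center a0 a1 a2 b0 b1 b2 -> a0 = 0 /\ b0 = 0 /\ a2 * b1 - a1 * b2 = 0.
Proof.
intros [eps [Heps Hc]].
set (A := coefA a0 a1 a2); set (B := coefA b0 b1 b2).
assert (CA : forall t, continuous A t) by apply continuous_coefA.
assert (CB : forall t, continuous B t) by apply continuous_coefA.
destruct (small_solution B A CB CA) as [C [del [HC [Hdel H]]]].
destruct (cont01_bounded A) as [MA [MA0 HMA]]; [intros t _; auto|].
destruct (cont01_bounded B) as [MB [MB0 HMB]]; [intros t _; auto|].
(* The last bound gives [C * xi ^ 2 <= xi / 2], which keeps [w] positive and below [2 * xi]. *)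
set (d := Rmin (Rmin del (eps / 2)) (/ (2 * C))).
assert (Hd : 0 < d).
{ unfold d; repeat apply Rmin_pos; try lra; apply Rinv_0_lt_compat; lra. }
assert (Hw : forall xi, 0 < xi <= d -> exists w, solves A B w /\ w 0 = xi /\
  (forall t, 0 <= t <= 1 -> Rabs (w t - xi) <= C * xi ^ 2) /\
  (forall t, 0 <= t <= 1 -> 0 < w t <= 2 * xi) /\
  is_RInt (fun t => A t * w t + B t) 0 1 0).
{ intros xi Hxi.
  pose proof (Rmin_l (Rmin del (eps / 2)) (/ (2 * C))); fold d in H0.
  pose proof (Rmin_r (Rmin del (eps / 2)) (/ (2 * C))); fold d in H1.
  pose proof (Rmin_l del (eps / 2)); pose proof (Rmin_r del (eps / 2)).
  destruct (H xi) as [w [w0 [dw Hwb]]]; [rewrite Rabs_pos_eq; lra|].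
  assert (Hw : solves A B w).
  { intros t Ht; rewrite Rplus_comm; apply dw, Ht. }
  assert (HCx : C * xi ^ 2 <= xi / 2).
  { assert (C * xi <= C * / (2 * C)) by (apply Rmult_le_compat_l; lra).
    replace (C * / (2 * C)) with (/ 2) in H4 by (field; lra); nra. }
  assert (Hpos : forall t, 0 <= t <= 1 -> 0 < w t <= 2 * xi).
  { intros t Ht; specialize (Hwb t Ht); apply Rabs_le_between in Hwb; lra. }
  exists w; do 4 (split; [assumption|]).
  apply is_RInt_ext01 with
    (fun t => (A t * w t ^ 3 + B t * w t ^ 2) * (1 / w t ^ 2)).
  - intros t Ht; specialize (Hpos t ltac:(lra)); field; lra.
  - apply (integral_periodic A B w (fun v => 1 / v ^ 2)); auto.
    + rewrite w0; symmetry; apply (Hc xi); auto; rewrite Rabs_pos_eq; lra.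
    + intros t Ht; specialize (Hpos t Ht); continuity; apply pow_nonzero; lra. }
assert (IA := integral_coefA a0 a1 a2); fold A in IA.
assert (IB := integral_coefA b0 b1 b2); fold B in IB.
(* Order 0: [b0] is minus the integral of [A w], which is O(xi). *)
assert (Hb0 : b0 = 0).
{ apply (eq0_of_linear_bound _ (2 * MA) d Hd); intros xi Hxi.
  destruct (Hw xi Hxi) as [w [Sw [w0 [Wb [Wp I]]]]].
  rewrite <- Rabs_Ropp, <- Rminus_0_l.
  apply (integral_bound01 (fun t => A t * w t)).
  - apply is_RInt_ext01 with (fun t => A t * w t + B t - B t); [intros; ring|].
    apply is_RInt_Rminus; auto.
  - intros t Ht; rewrite Rabs_mult.
    specialize (HMA t ltac:(lra)); specialize (Wp t ltac:(lra)).
    rewrite (Rabs_pos_eq (w t)) by lra; pose proof (Rabs_pos (A t)); nra. }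
assert (IAw : forall xi, 0 < xi <= d -> forall w, is_RInt (fun t => A t * w t + B t) 0 1 0 ->
  is_RInt (fun t => A t * (w t - xi)) 0 1 (- (xi * a0))).
{ intros xi Hxi w I.
  apply is_RInt_ext01 with (fun t => (A t * w t + B t - B t) - xi * A t); [intros; ring|].
  replace (- (xi * a0)) with (0 - b0 - xi * a0) by (rewrite Hb0; ring).
  apply is_RInt_Rminus; [apply is_RInt_Rminus; assumption | apply (is_RInt_scal A), IA]. }
(* Order 1: [xi * a0] is minus the integral of [A (w - xi)], which is O(xi^2). *)
assert (Ha0 : a0 = 0).
{ apply (eq0_of_linear_bound _ (MA * C) d Hd); intros xi Hxi.
  destruct (Hw xi Hxi) as [w [Sw [w0 [Wb [Wp I]]]]].
  apply Rmult_le_reg_l with xi; [lra|].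
  replace (xi * Rabs a0) with (Rabs (- (xi * a0)))
    by (rewrite Rabs_Ropp, Rabs_mult, (Rabs_pos_eq xi) by lra; reflexivity).
  apply (integral_bound01 _ _ _ (IAw xi Hxi w I)); intros t Ht; rewrite Rabs_mult.
  specialize (HMA t ltac:(lra)); specialize (Wb t ltac:(lra)).
  replace (xi * (MA * C * xi)) with (MA * (C * xi ^ 2)) by ring.
  apply Rmult_le_compat; auto using Rabs_pos. }
split; [exact Ha0|]; split; [exact Hb0|].
set (Bt := coefA_primitive b0 b1 b2).
assert (IAB : is_RInt (fun t => A t * Bt t) 0 1 ((a2 * b1 - a1 * b2) / (4 * PI))).
{ unfold A, Bt; rewrite Ha0, Hb0; apply integral_coefA_primitive. }
set (kap := (a2 * b1 - a1 * b2) / (4 * PI)) in IAB.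
assert (HP := PI_neq0).
(* Order 2: the expansion [w = xi + xi^2 Bt + O(xi^3)] makes [xi ^ 2 * kap] of order [xi^3]. *)
assert (Hk : kap = 0).
{ apply (eq0_of_linear_bound _ (MA * (MB * (3 * C) + MA * 8)) d Hd); intros xi Hxi.
  destruct (Hw xi Hxi) as [w [Sw [w0 [Wb [Wp I]]]]].
  assert (I2 : is_RInt (fun t => A t * (w t - xi - xi ^ 2 * Bt t)) 0 1 (- (xi ^ 2 * kap))).
  { apply is_RInt_ext01 with (fun t => A t * (w t - xi) - xi ^ 2 * (A t * Bt t)); [intros; ring|].
    replace (- (xi ^ 2 * kap)) with (- (xi * a0) - xi ^ 2 * kap) by (rewrite Ha0; ring).
    apply is_RInt_Rminus; auto; apply (is_RInt_scal (fun t => A t * Bt t)), IAB. }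
  (* The derivative of the remainder is [B (w - xi) (w + xi) + A w^3]; the bounds [w + xi <= 3 * xi]
     and [w <= 2 * xi] produce the constants 3 and 8. *)
  assert (W2 : forall t, 0 <= t <= 1 ->
    Rabs (w t - xi - xi ^ 2 * Bt t) <= xi ^ 3 * (MB * (3 * C) + MA * 8)).
  { intros t Ht.
    replace (w t - xi - xi ^ 2 * Bt t)
      with ((w t - xi - xi ^ 2 * Bt t) - (w 0 - xi - xi ^ 2 * Bt 0))
      by (unfold Bt; rewrite w0, coefA_primitive_0; ring).
    apply (derive_bounded (fun t => w t - xi - xi ^ 2 * Bt t)
      (fun t => A t * w t ^ 3 + B t * w t ^ 2 - xi ^ 2 * B t)); auto; intros s Hs.
    - pose proof (is_derive_coefA_primitive b0 b1 b2 s) as dB.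
      fold Bt in dB; fold B in dB; specialize (Sw s Hs).
      auto_derive.
      + repeat split; eexists; eassumption.
      + rewrite_derive Sw; rewrite_derive dB; ring.
    - specialize (Wb s Hs); specialize (Wp s Hs);
        specialize (HMA s Hs); specialize (HMB s Hs).
      replace (A s * w s ^ 3 + B s * w s ^ 2 - xi ^ 2 * B s)
        with (B s * ((w s - xi) * (w s + xi)) + A s * w s ^ 3) by ring.
      apply Rle_trans with (1 := Rabs_triang _ _).
      replace (xi ^ 3 * (MB * (3 * C) + MA * 8))
        with (MB * (C * xi ^ 2 * (3 * xi)) + MA * (2 * xi) ^ 3) by ring.
      rewrite !Rabs_mult, (Rabs_pos_eq (w s ^ 3)), (Rabs_pos_eq (w s + xi))
        by (try apply pow_le; lra).
      apply Rplus_le_compat; apply Rmult_le_compat; auto using Rabs_pos.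
      + apply Rmult_le_pos; [apply Rabs_pos | lra].
      + apply Rmult_le_compat; auto using Rabs_pos; lra.
      + apply pow_le; lra.
      + apply pow_incr; lra. }
  assert (Hx2 : 0 < xi ^ 2) by (apply pow_lt; lra).
  apply Rmult_le_reg_l with (xi ^ 2); [lra|].
  replace (xi ^ 2 * Rabs kap) with (Rabs (- (xi ^ 2 * kap)))
    by (rewrite Rabs_Ropp, Rabs_mult, (Rabs_pos_eq (xi ^ 2)) by lra; reflexivity).
  apply (integral_bound01 _ _ _ I2); intros t Ht; rewrite Rabs_mult.
  specialize (HMA t ltac:(lra)); specialize (W2 t ltac:(lra)).
  replace (xi ^ 2 * (MA * (MB * (3 * C) + MA * 8) * xi))
    with (MA * (xi ^ 3 * (MB * (3 * C) + MA * 8))) by ring.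
  apply Rmult_le_compat; auto using Rabs_pos. }
replace (a2 * b1 - a1 * b2) with (4 * PI * kap) by (unfold kap; field; auto).
rewrite Hk; ring.
Qed.

(** The common factor has mean zero, so every solution on [0,1] is periodic; [small_solution]
    supplies existence near 0. *)
Lemma separable_center (c1 c2 a0 a1 a2 b0 b1 b2 p q : R) :
  (forall t, coefA a0 a1 a2 t = q * coefA 0 c1 c2 t) ->
  (forall t, coefA b0 b1 b2 t = - p * coefA 0 c1 c2 t) ->
  has_center a0 a1 a2 b0 b1 b2.
Proof.
intros HA HB.
destruct (small_solution (coefA b0 b1 b2) (coefA a0 a1 a2)) as [C [del [_ [Hdel H]]]]; auto.
exists del; split; [exact Hdel|]; intros x0 Hx0; split.
- destruct (H x0) as [w [w0 [dw _]]]; [lra|].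
  exists w; split; [|exact w0].
  intros t Ht; unfold abel_field; rewrite Rplus_comm; apply dw, Ht.
- intros x Hx E; rewrite <- E.
  apply (separable_periodic _ _ (coefA 0 c1 c2) x p q) with (4 := Hx); auto.
  apply integral_coefA.
Qed.

Lemma center_iff (a0 a1 a2 b0 b1 b2 : R) :
  has_center a0 a1 a2 b0 b1 b2 <-> (a0 = 0 /\ b0 = 0 /\ a2 * b1 - a1 * b2 = 0).
Proof.
split; [apply center_coefficients|]; intros [-> [-> E]].
(* The vanishing determinant makes the two coefficients proportional: either the cubic one is zero,
   or the quadratic one is [m] times it. *)
destruct (Req_dec (a1 ^ 2 + a2 ^ 2) 0) as [Z|Z].
- assert (a1 = 0) by nra; assert (a2 = 0) by nra; subst.
  apply (separable_center b1 b2 _ _ _ _ _ _ (-1) 0); intros t; unfold coefA; ring.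
- set (m := (a1 * b1 + a2 * b2) / (a1 ^ 2 + a2 ^ 2)).
  apply (separable_center a1 a2 _ _ _ _ _ _ (- m) 1); intros t; [unfold coefA; ring|].
  assert (E1 : b1 = m * a1).
  { transitivity (m * a1 + a2 * (a2 * b1 - a1 * b2) / (a1 ^ 2 + a2 ^ 2)).
    - unfold m; field; auto.
    - rewrite E; field; auto. }
  assert (E2 : b2 = m * a2).
  { transitivity (m * a2 - a1 * (a2 * b1 - a1 * b2) / (a1 ^ 2 + a2 ^ 2)).
    - unfold m; field; auto.
    - rewrite E; field; auto. }
  unfold coefA; rewrite E1, E2; ring.
Qed.

(** * Nonnegative and vanishing combinations of the two coefficients *)

Lemma coefA_comb (p q a0 a1 a2 b0 b1 b2 t : R) :
  p * coefA a0 a1 a2 t + q * coefA b0 b1 b2 t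
  = coefA (p * a0 + q * b0) (p * a1 + q * b1) (p * a2 + q * b2) t.
Proof. unfold coefA; ring. Qed.

Lemma coefA_nonneg (c0 c1 c2 t : R) :
  0 <= c0 -> c1 ^ 2 + c2 ^ 2 <= c0 ^ 2 -> 0 <= coefA c0 c1 c2 t.
Proof.
intros H0 H; unfold coefA.
pose proof (sin2_cos2 (2 * PI * t)) as E; unfold Rsqr in E.
set (c := cos (2 * PI * t)) in *; set (s := sin (2 * PI * t)) in *.
(* Lagrange's identity, which bounds the oscillating part by [c0] in absolute value. *)
assert (L : (c1 * c + c2 * s) ^ 2 + (c1 * s - c2 * c) ^ 2 = c1 ^ 2 + c2 ^ 2).
{ transitivity ((c1 ^ 2 + c2 ^ 2) * (s * s + c * c)); [ring | rewrite E; ring]. }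
pose proof (pow2_ge_0 (c1 * s - c2 * c)); nra.
Qed.

Lemma coefA_zero (c0 c1 c2 : R) :
  (forall t, 0 < t < 1 -> coefA c0 c1 c2 t = 0) -> c0 = 0 /\ c1 = 0 /\ c2 = 0.
Proof.
intros H; unfold coefA in H.
pose proof (H (1/4) ltac:(lra)) as H1; pose proof (H (1/2) ltac:(lra)) as H2;
  pose proof (H (3/4) ltac:(lra)) as H3.
replace (2 * PI * (1/4)) with (PI / 2) in H1 by field.
replace (2 * PI * (1/2)) with PI in H2 by field.
replace (2 * PI * (3/4)) with (3 * (PI / 2)) in H3 by field.
rewrite cos_PI2, sin_PI2 in H1; rewrite cos_PI, sin_PI in H2.
rewrite cos_3PI2, sin_3PI2 in H3; lra.
Qed.

(* The three alternatives say that the quadratic form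
   [Q(p,q) = (p a0 + q b0)^2 - (p a1 + q b1)^2 - (p a2 + q b2)^2] has a
   nonnegative diagonal entry or a nonpositive determinant. *)
Lemma definite_combination (a0 a1 a2 b0 b1 b2 : R) :
  (a0 ^ 2 >= a1 ^ 2 + a2 ^ 2 \/ b0 ^ 2 >= b1 ^ 2 + b2 ^ 2 \/
   (a2 * b0 - a0 * b2) ^ 2 + (a0 * b1 - a1 * b0) ^ 2 >= (a2 * b1 - a1 * b2) ^ 2) ->
  exists p q, p ^ 2 + q ^ 2 <> 0 /\ 0 <= p * a0 + q * b0 /\
    (p * a1 + q * b1) ^ 2 + (p * a2 + q * b2) ^ 2 <= (p * a0 + q * b0) ^ 2.
Proof.
intros H.
assert (H' : exists p q, p ^ 2 + q ^ 2 <> 0 /\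
  (p * a1 + q * b1) ^ 2 + (p * a2 + q * b2) ^ 2 <= (p * a0 + q * b0) ^ 2).
{ destruct (Rle_lt_dec (a1 ^ 2 + a2 ^ 2) (a0 ^ 2)) as [L|L].
  { exists 1, 0; split; nra. }
  destruct H as [H|[H|H]]; [lra| |].
  { exists 0, 1; split; nra. }
  set (Qa := a0 ^ 2 - a1 ^ 2 - a2 ^ 2).
  set (m := a0 * b0 - a1 * b1 - a2 * b2).
  assert (HQ : Qa < 0) by (unfold Qa; lra).
  (* For [q = Qa] the form is largest at [p = - m], as [Qa < 0]; its value there is [Qa] times its
     determinant. *)
  exists (- m), Qa; split; [nra|].
  apply Rminus_le.
  replace (_ - _) with (Qa * ((a2 * b0 - a0 * b2) ^ 2 + (a0 * b1 - a1 * b0) ^ 2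
                              - (a2 * b1 - a1 * b2) ^ 2)) by (unfold Qa, m; ring).
  nra. }
destruct H' as [p [q [N L]]].
(* Changing the sign of both [p] and [q] preserves the quadratic inequality and makes the mean
   nonnegative. *)
destruct (Rle_lt_dec 0 (p * a0 + q * b0)) as [S|S].
- exists p, q; auto.
- exists (- p), (- q); repeat split; nra.
Qed.

(** Each pair of coefficients is orthogonal to [(p, q)], hence a multiple of [(q, - p)], the factor
    being found by projection. A common factor of mean zero would give a center. *)
Lemma not_center_separable (a0 a1 a2 b0 b1 b2 p q : R) :
  ~ has_center a0 a1 a2 b0 b1 b2 -> p ^ 2 + q ^ 2 <> 0 ->
  (forall t, 0 < t < 1 -> p * coefA a0 a1 a2 t + q * coefA b0 b1 b2 t = 0) ->
  exists c0 c1 c2, c0 <> 0 /\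
    (forall t, coefA a0 a1 a2 t = q * coefA c0 c1 c2 t) /\
    (forall t, coefA b0 b1 b2 t = - p * coefA c0 c1 c2 t).
Proof.
intros HC N HD.
destruct (coefA_zero (p * a0 + q * b0) (p * a1 + q * b1) (p * a2 + q * b2))
  as [Z0 [Z1 Z2]].
{ intros t Ht; rewrite <- coefA_comb; auto. }
set (n := p ^ 2 + q ^ 2) in N.
set (c := fun a b => (q * a - p * b) / n).
assert (Ea : forall a b, p * a + q * b = 0 -> a = q * c a b).
{ intros a b Z; transitivity (q * c a b + p * (p * a + q * b) / n).
  - unfold c, n; field; exact N.
  - rewrite Z; field; exact N. }
assert (Eb : forall a b, p * a + q * b = 0 -> b = - p * c a b).
{ intros a b Z; transitivity (- p * c a b + q * (p * a + q * b) / n).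
  - unfold c, n; field; exact N.
  - rewrite Z; field; exact N. }
assert (HA : forall t, coefA a0 a1 a2 t = q * coefA (c a0 b0) (c a1 b1) (c a2 b2) t).
{ intros t; unfold coefA; rewrite (Ea _ _ Z0), (Ea _ _ Z1), (Ea _ _ Z2) at 1; ring. }
assert (HB : forall t, coefA b0 b1 b2 t = - p * coefA (c a0 b0) (c a1 b1) (c a2 b2) t).
{ intros t; unfold coefA; rewrite (Eb _ _ Z0), (Eb _ _ Z1), (Eb _ _ Z2) at 1; ring. }
exists (c a0 b0), (c a1 b1), (c a2 b2); repeat split; auto.
intros E; apply HC; rewrite E in HA, HB.
eapply separable_center; eauto.
Qed.

(** Off this level, separation of variables would equate [- c0] with an integral over a degenerate
    interval. *)
Lemma separable_periodic_level (A B x : R -> R) (c0 c1 c2 p q : R) :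
  c0 <> 0 ->
  (forall t, A t = q * coefA c0 c1 c2 t) -> (forall t, B t = - p * coefA c0 c1 c2 t) ->
  solves A B x -> x 0 = x 1 -> x 0 <> 0 -> p - q * x 0 = 0.
Proof.
intros Hc HA HB Hx E N.
destruct (Req_dec (p - q * x 0) 0) as [|N2]; [assumption|exfalso].
destruct (separable_integral A B (coefA c0 c1 c2) x p q) as [_ I]; auto.
rewrite E, (RInt_point (x 1)) in I.
assert (J := is_RInt_opp (coefA c0 c1 c2) 0 1 c0 (integral_coefA c0 c1 c2)).
assert (Z : - c0 = 0).
{ rewrite <- (is_RInt_unique _ _ _ _ J : _ = - c0).
  apply (is_RInt_unique (fun t => - coefA c0 c1 c2 t)), I. }
lra.
Qed.

(** * Two hyperbolic orbits and the sign criterion for trigonometric coefficients *)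

Lemma criterion_theorem (a0 a1 a2 b0 b1 b2 : R) :
  ~ has_center a0 a1 a2 b0 b1 b2 ->
  (a0 ^ 2 >= a1 ^ 2 + a2 ^ 2 \/
   b0 ^ 2 >= b1 ^ 2 + b2 ^ 2 \/
   (a2 * b0 - a0 * b2) ^ 2 + (a0 * b1 - a1 * b0) ^ 2 >= (a2 * b1 - a1 * b2) ^ 2) ->
  let A := coefA a0 a1 a2 in let B := coefA b0 b1 b2 in
  (forall x y, solves A B x -> x 0 = x 1 -> x 0 <> 0 ->
     solves A B y -> y 0 = y 1 -> y 0 <> 0 -> x 0 = y 0) /\
  (forall x, solves A B x -> x 0 = x 1 -> x 0 <> 0 ->
     hyperbolic a0 a1 a2 b0 b1 b2 (x 0)).
Proof.
intros HC H A B.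
destruct (definite_combination _ _ _ _ _ _ H) as [p [q [N [H0 HQ]]]].
assert (CA : forall t, continuous A t) by apply continuous_coefA.
assert (CB : forall t, continuous B t) by apply continuous_coefA.
assert (HD : forall t, 0 <= t <= 1 -> 0 <= p * A t + q * B t).
{ intros t _; unfold A, B; rewrite coefA_comb; apply coefA_nonneg; assumption. }
destruct (classic (exists t, 0 < t < 1 /\ p * A t + q * B t <> 0)) as [[t0 [Ht0 D0]]|Z].
{ split.
  - intros x y; intros; apply (criterion_unique A B x y p q t0); auto.
  - intros x Hx E Nx.
    destruct (criterion_hyperbolic A B x p q t0) as [l [Hl I]]; auto.
    apply (hyperbolic_integral _ _ _ _ _ _ x l); auto. }
(* The combination vanishes identically: a nonzero periodic orbit can only be the constant solution
   [p / q]. *)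
destruct (not_center_separable a0 a1 a2 b0 b1 b2 p q HC N) as [c0 [c1 [c2 [Hc [HA HB]]]]].
{ intros t Ht; destruct (Req_dec (p * A t + q * B t) 0) as [|D]; [assumption|].
  exfalso; apply Z; exists t; auto. }
assert (L : forall x, solves A B x -> x 0 = x 1 -> x 0 <> 0 -> p - q * x 0 = 0).
{ intros x; apply (separable_periodic_level A B x c0 c1 c2); auto. }
assert (Hq : forall x, solves A B x -> x 0 = x 1 -> x 0 <> 0 -> q <> 0).
{ intros x Hx E Nx Q; specialize (L x Hx E Nx); rewrite Q in *; nra. }
split.
- intros x y Hx Ex Nx Hy Ey Ny.
  specialize (Hq x Hx Ex Nx).
  apply Rmult_eq_reg_l with q; auto.
  pose proof (L x Hx Ex Nx); pose proof (L y Hy Ey Ny); lra.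
- intros x Hx Ex Nx.
  specialize (L x Hx Ex Nx); specialize (Hq x Hx Ex Nx).
  (* At a constant [x] with [p = q x], the integrand [3 A x^2 + 2 B x] reduces to [q x^2] times the
     common factor, whose mean is [c0]. *)
  apply (hyperbolic_integral _ _ _ _ _ _ x (q * x 0 ^ 2 * c0)); auto.
  + apply is_RInt_ext01 with (fun t => q * x 0 ^ 2 * coefA c0 c1 c2 t).
    * intros t Ht.
      rewrite HA, HB, (separable_equilibrium A B (coefA c0 c1 c2) x p q) with (t := t);
        auto; try lra.
      replace p with (q * x 0) by lra; ring.
    * apply (is_RInt_scal (coefA c0 c1 c2)), integral_coefA.
  + repeat apply Rmult_integral_contrapositive_currified; auto; lra.
Qed.

(** * A reversible equation with two hyperbolic periodic orbits *)

(** Subtracting [2 x' / x], which integrates to zero along a nonvanishing periodic orbit, from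
    [3 A x^2 + 2 B x] leaves [A x^2]. *)
Lemma hyperbolic_of_cubic_part (a0 a1 a2 b0 b1 b2 : R) (x : R -> R) (l : R) :
  let A := coefA a0 a1 a2 in let B := coefA b0 b1 b2 in
  solves A B x -> x 0 = x 1 -> (forall t, 0 <= t <= 1 -> x t <> 0) ->
  is_RInt (fun t => A t * x t ^ 2) 0 1 l -> l <> 0 ->
  hyperbolic a0 a1 a2 b0 b1 b2 (x 0).
Proof.
intros A B Hx E N I Hl.
assert (J : is_RInt (fun t => (A t * x t ^ 3 + B t * x t ^ 2) * (2 / x t)) 0 1 0).
{ apply (integral_periodic A B x (fun v => 2 / v)); auto;
    try (intros t; apply continuous_coefA).
  intros t Ht; continuity; auto. }
apply (hyperbolic_integral _ _ _ _ _ _ x l); auto.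
apply is_RInt_ext01 with
  (fun t => A t * x t ^ 2 - - ((A t * x t ^ 3 + B t * x t ^ 2) * (2 / x t))).
- intros t Ht; specialize (N t ltac:(lra)); fold A; fold B; field; auto.
- replace l with (l - - 0) by ring; apply is_RInt_Rminus; [exact I|].
  apply (is_RInt_opp (fun t => (A t * x t ^ 3 + B t * x t ^ 2) * (2 / x t)) 0 1 0), J.
Qed.

Lemma reversed_solution (a b0 b1 : R) (x : R -> R) :
  solves (coefA 0 0 a) (coefA b0 b1 0) x ->
  solves (coefA 0 0 a) (coefA b0 b1 0) (fun t => - x (1 - t)).
Proof.
intros Hx t Ht.
assert (dx := Hx (1 - t) ltac:(lra)).
auto_derive.
- repeat split; eexists; eassumption.
- change (1 + - t) with (1 - t); rewrite_derive dx; unfold coefA.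
  replace (2 * PI * (1 - t)) with (- (2 * PI * t) + 2 * PI) by ring.
  rewrite cos_plus, sin_plus, cos_2PI, sin_2PI, cos_neg, sin_neg; ring.
Qed.

(** Used with [s] the sine and [1 / v] the orbit. The expansion of [s / (1 - s / 4)^2] begins with
    [s + s^2 / 2]; half of the square is kept, and its mean 1/8 exceeds the loss 1/10. *)
Lemma inverse_square_perturbation (s v : R) :
  -1 <= s <= 1 -> Rabs (v - (1 - s / 4)) <= 1 / 250 ->
  s + s * s / 4 - 1 / 10 <= s / v ^ 2.
Proof.
intros Hs Hv; set (v0 := 1 - s / 4) in Hv.
assert (H0 : 3/4 <= v0 <= 5/4) by (unfold v0; lra).
apply Rabs_le_between in Hv.
assert (H1 : 7/10 <= v <= 13/10) by lra.
assert (E0 : s + s * s / 4 <= s / v0 ^ 2).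
{ apply Rle_div_r; [nra|].
  apply Rminus_le; unfold v0.
  replace (_ - _) with (- (s * s * (1/4 + s / 16 - s * s / 64))) by field.
  assert (0 <= s * s * (1/4 + s / 16 - s * s / 64)) by (apply Rmult_le_pos; nra).
  lra. }
assert (E1 : s / v0 ^ 2 - 1/10 <= s / v ^ 2).
{ apply Rminus_le.
  replace (_ - _) with ((s * ((v - v0) * (v + v0)) - (v0 * v) ^ 2 / 10) / (v0 * v) ^ 2)
    by (field; lra).
  assert (P : 1/4 <= (v0 * v) ^ 2).
  { assert (1/2 <= v0 * v) by nra; nra. }
  apply Rle_div_l; [lra|]; rewrite Rmult_0_l.
  assert (-(1/50) <= (v - v0) * (v + v0) <= 1/50) by (split; nra).
  assert (s * ((v - v0) * (v + v0)) <= 1/50) by nra.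
  lra. }
lra.
Qed.

Lemma integral_sine_square :
  is_RInt (fun t => sin (2 * PI * t) + sin (2 * PI * t) * sin (2 * PI * t) / 4 - 1/10)
    0 1 (1/40).
Proof.
assert (HP := PI_neq0).
set (F := fun t => - cos (2 * PI * t) / (2 * PI)
  + (t / 2 - sin (2 * PI * t) * cos (2 * PI * t) / (4 * PI)) / 4 - t / 10).
replace (1/40) with (F 1 - F 0).
- apply integral_derive.
  + intros t _; unfold F; auto_derive; auto.
    pose proof (sin2_cos2 (2 * PI * t)) as E; unfold Rsqr in E.
    set (c := cos (2 * PI * t)) in *; set (s := sin (2 * PI * t)) in *.
    match goal with |- _ = ?r =>
      transitivity (r + 1/8 * (1 - (s * s + c * c)))
    end; [field; auto | rewrite E; ring].
  + intros t _.
    apply (ex_derive_continuous (fun t =>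
      sin (2 * PI * t) + sin (2 * PI * t) * sin (2 * PI * t) / 4 - 1/10)).
    auto_derive; auto.
- unfold F; rewrite sin_2PI_1, cos_2PI_1, !Rmult_0_r, sin_0, cos_0; field; auto.
Qed.

Definition sin2pi (t : R) : R := sin (2 * PI * t).

Lemma continuous_sin2pi (t : R) : continuous sin2pi t.
Proof. apply (ex_derive_continuous sin2pi); unfold sin2pi; auto_derive; auto. Qed.

(* With [u = 1/x] the equation with cubic part [sin/1000] becomes
   [u' = - b0 - b1 cos - sin/(1000 u)]; [b0] is not fixed in advance but chosen, as a
   functional of [u], so that every iterate is periodic. *)
Lemma two_orbits_fixed_point :
  exists u I, (forall t, Rabs (u t - 1) <= 1/2) /\ (forall t, continuous u t) /\
    I = RInt (fun s => sin2pi s / u s) 0 1 /\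
    forall t, 0 <= t <= 1 ->
      u t = 1 - sin2pi t / 4
            - 1/1000 * (RInt (fun s => sin2pi s / u s) 0 t - t * I).
Proof.
set (G := fun (u : R -> R) s => sin2pi s / u s).
assert (Csin := continuous_sin2pi).
assert (Hsin : forall t, Rabs (sin2pi t) <= 1).
{ intros t; apply Rabs_le; apply SIN_bound. }
assert (Hu : forall u : R, Rabs (u - 1) <= 1/2 -> 1/2 <= u).
{ intros u H; apply Rabs_le_between in H; lra. }
assert (CG : forall u, (forall t, continuous u t) -> (forall t, Rabs (u t - 1) <= 1/2) ->
  forall t, continuous (G u) t).
{ intros u Cu Bu t; unfold G; specialize (Bu t); apply Hu in Bu; continuity; lra. }
assert (BG : forall u : R -> R, (forall t, Rabs (u t - 1) <= 1/2) ->
  forall t, Rabs (G u t) <= 2).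
{ intros u Bu t; unfold G; specialize (Bu t); apply Hu in Bu; specialize (Hsin t).
  unfold Rdiv; rewrite Rabs_mult, Rabs_inv, (Rabs_pos_eq (u t)) by lra.
  apply Rle_div_l; lra. }
assert (DG : forall (u v : R -> R) d, (forall t, Rabs (u t - 1) <= 1/2) ->
  (forall t, Rabs (v t - 1) <= 1/2) -> (forall t, Rabs (u t - v t) <= d) ->
  forall t, Rabs (G u t - G v t) <= 4 * d).
{ intros u v d Bu Bv Hd t; unfold G.
  specialize (Bu t); specialize (Bv t); apply Hu in Bu; apply Hu in Bv.
  specialize (Hsin t); specialize (Hd t).
  replace (sin2pi t / u t - sin2pi t / v t) with (- (sin2pi t * (u t - v t)) / (u t * v t))
    by (field; lra).
  assert (P : 1/4 <= u t * v t) by nra.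
  unfold Rdiv; rewrite Rabs_mult, Rabs_inv, Rabs_Ropp, Rabs_mult,
    (Rabs_pos_eq (u t * v t)) by lra.
  apply Rle_div_l; [lra|].
  pose proof (Rabs_pos (sin2pi t)); pose proof (Rabs_pos (u t - v t)); nra. }
(* The sine over 4 is the primitive of [b1 cos] for [b1 = PI / 2]. Subtracting [t] times the full
   integral gives every iterate the value 1 at both ends, and 1/1000 makes [F] contract. *)
set (F := fun u t => 1 - sin2pi (clamp t) / 4
  - 1/1000 * (RInt (G u) 0 (clamp t) - clamp t * RInt (G u) 0 1)).
destruct (contraction_fixed_point F 1 (1/2)) as [u [[Cu Bu] Hfix]]; [lra| | |].
- intros u [Cu Bu]; specialize (CG u Cu Bu); specialize (BG u Bu); split; intros t; unfold F.
  + pose proof (continuous_clamp t).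
    assert (continuous (fun s => sin2pi (clamp s)) t)
      by (apply (continuous_comp_clamp sin2pi); intros s _; apply Csin).
    pose proof (continuous_RInt_clamp (G u) t CG).
    continuity; lra.
  + pose proof (clamp_range t) as Ht.
    assert (B1 := RInt_bound01 (G u) 2 (clamp t) CG Ht (fun s _ => BG s)).
    assert (B2 := RInt_bound01 (G u) 2 1 CG ltac:(lra) (fun s _ => BG s)).
    specialize (Hsin (clamp t)).
    apply Rabs_le_between in B1, B2, Hsin; apply Rabs_le.
    assert (-2 <= clamp t * RInt (G u) 0 1 <= 2) by (split; nra).
    split; lra.
- intros u v d [Cu Bu] [Cv Bv] Hd Huv t; unfold F.
  pose proof (clamp_range t) as Ht.
  specialize (DG u v d Bu Bv Huv).
  assert (B1 := RInt_diff_bound01 (G u) (G v) (4 * d) (clamp t) (CG u Cu Bu) (CG v Cv Bv)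
    Ht (fun s _ => DG s)).
  assert (B2 := RInt_diff_bound01 (G u) (G v) (4 * d) 1 (CG u Cu Bu) (CG v Cv Bv)
    ltac:(lra) (fun s _ => DG s)).
  apply Rabs_le_between in B1, B2; apply Rabs_le.
  assert (- (4 * d) <= clamp t * (RInt (G u) 0 1 - RInt (G v) 0 1) <= 4 * d) by (split; nra).
  split; lra.
- exists u, (RInt (G u) 0 1); do 2 (split; [assumption|]); split; [reflexivity|].
  intros t Ht; rewrite <- Hfix at 1; unfold F; rewrite clamp_id by exact Ht; reflexivity.
Qed.

Lemma two_hyperbolic_orbits :
  exists a0 a1 a2 b0 b1 b2 x0 y0 : R,
     x0 <> 0 /\ y0 <> 0 /\ x0 <> y0 /\
     periodic_ic a0 a1 a2 b0 b1 b2 x0 /\ periodic_ic a0 a1 a2 b0 b1 b2 y0 /\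
     hyperbolic a0 a1 a2 b0 b1 b2 x0 /\ hyperbolic a0 a1 a2 b0 b1 b2 y0.
Proof.
destruct two_orbits_fixed_point as [u [I [Bu [Cu [HI Hu]]]]].
set (g := fun s => sin2pi s / u s) in *.
assert (Hu2 : forall t, 1/2 <= u t).
{ intros t; specialize (Bu t); apply Rabs_le_between in Bu; lra. }
assert (Cg : forall t, continuous g t).
{ intros t; specialize (Hu2 t); pose proof (continuous_sin2pi t); unfold g; continuity; lra. }
assert (Hg : forall t, Rabs (g t) <= 2).
{ intros t; unfold g, Rdiv; specialize (Hu2 t).
  rewrite Rabs_mult, Rabs_inv, (Rabs_pos_eq (u t)) by lra.
  apply Rle_div_l; [lra|].
  assert (Rabs (sin2pi t) <= 1) by (apply Rabs_le; apply SIN_bound); lra. }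
(* The equation for [u] holds only on [0,1]; [v] is given by the formula everywhere, so it can be
   differentiated at the ends too. *)
set (v := fun t => 1 - sin2pi t / 4 - 1/1000 * (RInt g 0 t - t * I)).
assert (Ev : forall t, 0 <= t <= 1 -> v t = u t) by (intros; symmetry; apply Hu; assumption).
set (x := fun t => / v t).
set (A := coefA 0 0 (1/1000)); set (B := coefA (- (1/1000) * I) (PI / 2) 0).
assert (Hx : solves A B x).
{ intros t Ht.
  pose proof (derive_RInt_continuous g t Cg) as dg.
  specialize (Hu2 t).
  unfold x; rewrite (Ev t Ht).
  assert (dv : is_derive v t (- (PI / 2) * cos (2 * PI * t) - 1/1000 * (g t - I))).
  { unfold v, sin2pi.
    set (J := RInt g 0) in *.
    auto_derive; [repeat split; eexists; eassumption|].
    rewrite_derive dg; field. }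
  auto_derive.
  - repeat split; [eexists; eassumption | rewrite Ev; lra].
  - rewrite_derive dv; rewrite Ev by exact Ht.
    unfold A, B, coefA, g, sin2pi; field; lra. }
assert (v0 : v 0 = 1).
{ unfold v, sin2pi; rewrite Rmult_0_r, sin_0, (RInt_point 0 g); unfold zero; simpl; field. }
assert (v1 : v 1 = 1).
{ unfold v, sin2pi; rewrite sin_2PI_1, HI; field. }
assert (x0 : x 0 = 1) by (unfold x; rewrite v0; field).
assert (x1 : x 1 = 1) by (unfold x; rewrite v1; field).
assert (Nx : forall t, 0 <= t <= 1 -> x t <> 0).
{ intros t Ht; unfold x; specialize (Hu2 t); apply Rinv_neq_0_compat; rewrite Ev; lra. }
destruct (antiderivative01 (fun t => A t * x t ^ 2)) as [L [_ [_ IL]]].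
{ intros t Ht; pose proof (solves_cont01 _ _ _ Hx t Ht).
  assert (continuous A t) by apply continuous_coefA; continuity. }
assert (HL : 0 < L 1).
(* 1/40 is 1/8 - 1/10, the mean of the lower bound in [inverse_square_perturbation]. *)
{ apply Rlt_le_trans with (1/1000 * (1/40)); [lra|].
  apply (is_RInt_le (fun t => 1/1000 * (sin (2 * PI * t)
    + sin (2 * PI * t) * sin (2 * PI * t) / 4 - 1/10)) (fun t => A t * x t ^ 2) 0 1);
    [lra | apply (is_RInt_scal (fun t => sin (2 * PI * t)
    + sin (2 * PI * t) * sin (2 * PI * t) / 4 - 1/10)), integral_sine_square | exact IL |].
  intros t Ht.
  replace (A t * x t ^ 2) with (1/1000 * (sin (2 * PI * t) / v t ^ 2)).
  - apply Rmult_le_compat_l; [lra|].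
    apply inverse_square_perturbation; [apply SIN_bound|].
    unfold v, sin2pi.
    assert (B1 := RInt_bound01 g 2 t Cg ltac:(lra) (fun s _ => Hg s)).
    assert (B2 := RInt_bound01 g 2 1 Cg ltac:(lra) (fun s _ => Hg s)).
    rewrite <- HI in B2.
    apply Rabs_le_between in B1, B2; apply Rabs_le.
    assert (-2 <= t * I <= 2) by (split; nra).
    split; lra.
  - specialize (Hu2 t); unfold A, coefA, x; rewrite Ev by lra; field; lra. }
set (y := fun t => - x (1 - t)).
assert (Hy : solves A B y) by (apply reversed_solution, Hx).
assert (y0 : y 0 = -1) by (unfold y; rewrite Rminus_0_r, x1; reflexivity).
assert (y1 : y 1 = -1) by (unfold y; rewrite Rminus_diag, x0; reflexivity).
(* Reversing time changes the sign of [A] but not of the square, so the two orbits have reciprocal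
   multipliers. *)
assert (IY : is_RInt (fun t => A t * y t ^ 2) 0 1 (- L 1)).
{ apply is_RInt_ext01 with (fun t => -1 * (A (-1 * t + 1) * x (-1 * t + 1) ^ 2)).
  - intros t Ht; unfold y.
    replace (-1 * t + 1) with (1 - t) by ring.
    unfold A, coefA.
    replace (2 * PI * (1 - t)) with (- (2 * PI * t) + 2 * PI) by ring.
    rewrite cos_plus, sin_plus, cos_2PI, sin_2PI, cos_neg, sin_neg; ring.
  - apply (is_RInt_comp_lin (fun t => A t * x t ^ 2) (-1) 1 0 1).
    replace (-1 * 0 + 1) with 1 by ring; replace (-1 * 1 + 1) with 0 by ring.
    apply (is_RInt_swap (fun t => A t * x t ^ 2)), IL. }
exists 0, 0, (1/1000), (- (1/1000) * I), (PI / 2), 0, 1, (-1).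
do 3 (split; [lra|]); split; [|split; [|split]].
- exists x; auto.
- exists y; auto.
- assert (H := hyperbolic_of_cubic_part _ _ _ _ _ _ x (L 1) Hx).
  rewrite x0, x1 in H; apply H; auto; lra.
- assert (H := hyperbolic_of_cubic_part _ _ _ _ _ _ y (- L 1) Hy).
  rewrite y0, y1 in H; apply H; auto; try lra.
  intros t Ht; unfold y; specialize (Nx (1 - t) ltac:(lra)); lra.
Qed.

Theorem theoremB :
  (forall a0 a1 a2 b0 b1 b2 : R,
     has_center a0 a1 a2 b0 b1 b2 <->
     (a0 = 0 /\ b0 = 0 /\ a2 * b1 - a1 * b2 = 0)) /\
  (forall a0 a1 a2 b0 b1 b2 : R,
     ~ has_center a0 a1 a2 b0 b1 b2 ->
     (a0 ^ 2 >= a1 ^ 2 + a2 ^ 2 \/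
      b0 ^ 2 >= b1 ^ 2 + b2 ^ 2 \/
      (a2 * b0 - a0 * b2) ^ 2 + (a0 * b1 - a1 * b0) ^ 2 >= (a2 * b1 - a1 * b2) ^ 2) ->
     (forall x0 y0, x0 <> 0 -> y0 <> 0 ->
        periodic_ic a0 a1 a2 b0 b1 b2 x0 -> periodic_ic a0 a1 a2 b0 b1 b2 y0 -> x0 = y0) /\
     (forall x0, x0 <> 0 -> periodic_ic a0 a1 a2 b0 b1 b2 x0 ->
        hyperbolic a0 a1 a2 b0 b1 b2 x0)) /\
  (exists a0 a1 a2 b0 b1 b2 : R, exists x0 y0 : R,
     x0 <> 0 /\ y0 <> 0 /\ x0 <> y0 /\
     periodic_ic a0 a1 a2 b0 b1 b2 x0 /\ periodic_ic a0 a1 a2 b0 b1 b2 y0 /\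
     hyperbolic a0 a1 a2 b0 b1 b2 x0 /\ hyperbolic a0 a1 a2 b0 b1 b2 y0).

Proof.
split; [exact center_iff|]; split; [|exact two_hyperbolic_orbits].
intros a0 a1 a2 b0 b1 b2 HC H.
destruct (criterion_theorem a0 a1 a2 b0 b1 b2 HC H) as [U Hyp]; split.
- intros x0 y0 Nx Ny [x [Hx [<- Ex]]] [y [Hy [<- Ey]]]; apply U; auto.
- intros x0 Nx [x [Hx [<- Ex]]]; apply Hyp; auto.
Qed.
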